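(* For every $(\ell_1,\ell_3,b)\in P=\mathbb R^+\times\mathbb R^+\times[0,1]$ the vector fields $X_1,X_2$ generate a finite dimensional Lie subalgebra $\mathfrak s_{\ell_1,\ell_3,b}$ of $\mathfrak X(\mathcal M)$ over $\mathbb R$, and $\dim\mathfrak s_{\ell_1,\ell_3,b}\in\{6,8,9\}$ depending on the parameters. Every $(\ell_1,\ell_3,b)\in P$ belongs to one of the following branches (or to the equivalent one indicated), and in each branch the listed vector fields form a basis of $\mathfrak s_{\ell_1,\ell_3,b}$, with the indicated growth vector of $\mathfrak s_{\ell_1,\ell_3,b}$ with respect to $\{X_1,X_2\}$: 1) basis $X_1,\dots,X_5,X_{14}$, growth vector $(2,3,5,6)$, for a) $b=\tfrac12,\ \ell_1=\ell_3$; b) $\ell_1=b=1-\ell_3$. 2) basis $X_1,\dots,X_5,X_{14},X_{114},X_{214}$, growth vector $(2,3,5,6,8)$, for $b=\ell_1=\tfrac12\neq\ell_3$ (equivalent branch: $b=\ell_3=\tfrac12\ne\ell_1$). 3) basis $X_1,\dots,X_5,X_{14},X_{114},X_{214},X_{1114}$, growth vector $(2,3,5,6,8,9)$, for $b=\tfrac12,\ \ell_1\ne\ell_3,\ \ell_1\ne b,\ \ell_3\neq b$. 4) basis $X_1,\dots,X_5,X_{14},X_{25},X_{125}$, growth vector $(2,3,5,7,8)$, for $b=\ell_1=1$ (equivalent branch: $b=0,\ \ell_3=1$). 5) basis $X_1,\dots,X_5,X_{14},X_{25},X_{125},X_{225}$, growth vector $(2,3,5,7,9)$, for $b=\tfrac{\ell_1}{\ell_1+\ell_3},\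 \ell_1\neq\ell_3,\ \ell_1+\ell_3\ne1$. 6) basis $X_1,\dots,X_5,X_{14},X_{25},X_{214},X_{125}$, growth vector $(2,3,5,7,9)$, for $b=1,\ \ell_1\ne1$ (equivalent branch: $b=0,\ \ell_3\neq1$). 7) basis $X_1,\dots,X_5,X_{14},X_{25},X_{114}$, growth vector $(2,3,5,7,8)$, for $b=\ell_1,\ \ell_1+\ell_3\ne1,\ b\ne\tfrac12,1$ (equivalent branch: $b=1-\ell_3,\ \ell_1+\ell_3\neq1,\ b\neq0,\tfrac12$). 8) basis $X_1,\dots,X_5,X_{14},X_{25},X_{114},X_{214}$, growth vector $(2,3,5,7,9)$, for $b\notin\{0,\tfrac12,1,\ell_1,1-\ell_3,\tfrac{\ell_1}{\ell_1+\ell_3}\}$.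
   Context: $\mathcal M=S^1\times S^1\times S^1\times\mathbb R^2$ with coordinates $(v_1,v_2,v_3,x,y)$ ($v_i$ angles). For $\ell_1,\ell_3>0$, $b\in[0,1]$ let $$X_1=\Big(1+\tfrac{b}{\ell_1}\cos v_1\Big)\partial_{v_1}-\partial_{v_2}+\Big(1+\tfrac{1-b}{\ell_3}\cos v_3\Big)\partial_{v_3},$$ $$X_2=-\tfrac1{\ell_1}\sin v_1\,\partial_{v_1}+\tfrac1{\ell_3}\sin v_3\,\partial_{v_3}+\cos v_2\,\partial_x+\sin v_2\,\partial_y,$$ and $X_3=[X_1,X_2]$, $X_4=[X_1,X_3]$, $X_5=[X_2,X_3]$. For further iterated brackets write $X_{i_1i_2\dots i_k}=[X_{i_1},[X_{i_2},[\cdots[X_{i_{k-1}},X_{i_k}]\cdots]]]$, e.g. $X_{14}=[X_1,X_4]$, $X_{25}=[X_2,X_5]$, $X_{214}=[X_2,[X_1,X_4]]$, $X_{1114}=[X_1,[X_1,[X_1,X_4]]]$. Growth vector: for a Lie algebra $\mathfrak g$ and a subset $\mathfrak d\subset\mathfrak g$, put $\mathfrak d^1=\mathfrak d$, $\mathfrak d^{i+1}=\mathfrak d^i\cup\{[X,Y]\mid X\in\mathfrak d,\ Y\in\mathfrak d^i\}$, $\mathfrak D^i=\operatorname{span}_{\mathbb R}\mathfrak d^i$, and let $r$ be the least number with $\mathfrak D^r=\mathfrak D^{r+1}$. The growth vector of $\mathfrak g$ with respect to $\mathfrak d$ is $(\dim\mathfrak D^1,\dots,\dim\mathfrak D^r)$.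 Branches called equivalent correspond to each other under $(\ell_1,\ell_3,b)\mapsto(\ell_3,\ell_1,1-b)$. *)

(* Defs.v *)
From mathcomp Require Import all_boot all_order all_algebra.
From mathcomp Require Import all_classical all_reals all_analysis.

Set Implicit Arguments.
Unset Strict Implicit.
Unset Printing Implicit Defensive.

Import Order.TTheory GRing.Theory Num.Theory.
Import numFieldNormedType.Exports.

Local Open Scope classical_set_scope.
Local Open Scope ring_scope.

Section LinearAlgebra.
Variables (R : pzRingType) (V : lmodType R).
Implicit Types (A S : set V) (s : seq V).

Definition lin_span A : set V :=
  [set v | exists (n : nat) (a : 'I_n -> R) (w : 'I_n -> V),
     (forall i, A (w i)) /\ v = \sum_i a i *: w i].

Definition lin_free s :=
  forall a : 'I_(size s) -> R, \sum_i a i *: s`_i = 0 -> forall i, a i = 0.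

Definition is_basis S s := lin_free s /\ S = lin_span [set` s].

Definition has_dim S (n : nat) := exists2 s : seq V, size s = n & is_basis S s.

Variable br : V -> V -> V.

Definition lie_subalgebra (G L : set V) :=
  [/\ L `<=` G, L 0,
      forall (a : R) (X Y : V), L X -> L Y -> L (a *: X + Y)
    & forall X Y : V, L X -> L Y -> L (br X Y)].

Definition lie_generated (G d : set V) : set V := smallest (lie_subalgebra G) d.

(* The index is shifted by one: [gset d i] is d^{i+1} and [gspan d i] is
   D^{i+1}. *)
Fixpoint gset (d : set V) (i : nat) : set V :=
  if i is j.+1
  then gset d j `|` [set Z | exists X Y, [/\ d X, gset d j Y & Z = br X Y]]
  else d.

Definition gspan (d : set V) (i : nat) : set V := lin_span (gset d i).

(* [size g] is the least r >= 1 with D^r = D^{r+1}. *)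
Definition growth_vector (d : set V) (g : seq nat) :=
  [/\ (0 < size g)%N,
      gspan d (size g).-1 = gspan d (size g),
      forall i, (i.+1 < size g)%N -> gspan d i <> gspan d i.+1
    & forall i, (i < size g)%N -> has_dim (gspan d i) (nth 0%N g i)].

End LinearAlgebra.

Section VectorFields.
Variable R : realType.

(* The coordinate fields form a global frame of M = (S^1)^3 x R^2, and the
   coordinates (v1, v2, v3, x, y), numbered from 0, exhibit R^5 as its universal
   cover: a vector field on M is the map R^5 -> R^5 of its components, which is
   2 pi-periodic in each of the angles 0, 1, 2. *)
Definition vfield : Type := 'rV[R]_5 -> 'rV[R]_5.

Definition partial (j : 'I_5) (f : 'rV[R]_5 -> R) : 'rV[R]_5 -> R :=
  fun p => 'D_(delta_mx 0 j) f p.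

Definition smooth (f : 'rV[R]_5 -> R) :=
  forall js : seq 'I_5,
    continuous (foldr partial f js) /\
    forall (j : 'I_5) (p : 'rV[R]_5),
      derivable (foldr partial f js) p (delta_mx 0 j).

Definition component (X : vfield) (i : 'I_5) : 'rV[R]_5 -> R := fun p => X p 0 i.

Definition vector_fields : set vfield :=
  [set X | (forall i, smooth (component X i)) /\
           forall (j : 'I_5) (p : 'rV[R]_5),
             (j < 3)%N -> X (p + (2 * pi) *: delta_mx 0 j) = X p].

Definition lie_bracket (X Y : vfield) : vfield := fun p =>
  \row_i \sum_j (component X j p * partial j (component Y i) p
                 - component Y j p * partial j (component X i) p).

Definition field1 (l1 l3 b : R) : vfield := fun p =>
  \row_(i < 5) [:: 1 + b / l1 * cos (p 0 0); -1;
                   1 + (1 - b) / l3 * cos (p 0 2); 0; 0]`_i.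

Definition field2 (l1 l3 b : R) : vfield := fun p =>
  \row_(i < 5) [:: - (l1^-1 * sin (p 0 0)); 0; l3^-1 * sin (p 0 2);
                   cos (p 0 1); sin (p 0 1)]`_i.

Variables l1 l3 b : R.

(* In branches 2, 4, 6 and 7 the second case is the equivalent branch, i.e. the
   image of the first under (l1, l3, b) |-> (l3, l1, 1 - b); branches 1, 3, 5
   and 8 are invariant under this map. *)
Definition branch1 := (b = 1 / 2 /\ l1 = l3) \/ (l1 = b /\ b = 1 - l3).
Definition branch2 :=
  [/\ b = l1, l1 = 1 / 2 & 1 / 2 != l3] \/
  [/\ b = l3, l3 = 1 / 2 & 1 / 2 != l1].
Definition branch3 := [/\ b = 1 / 2, l1 != l3, l1 != b & l3 != b].
Definition branch4 := (b = l1 /\ l1 = 1) \/ (b = 0 /\ l3 = 1).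
Definition branch5 := [/\ b = l1 / (l1 + l3), l1 != l3 & l1 + l3 != 1].
Definition branch6 := (b = 1 /\ l1 != 1) \/ (b = 0 /\ l3 != 1).
Definition branch7 :=
  [/\ b = l1, l1 + l3 != 1, b != 1 / 2 & b != 1] \/
  [/\ b = 1 - l3, l1 + l3 != 1, b != 0 & b != 1 / 2].
Definition branch8 : Prop :=
  b \notin [:: 0; 1 / 2; 1; l1; 1 - l3; l1 / (l1 + l3)].

End VectorFields.

(* Main.v *)
Require Import Defs.
From HB Require Import structures.
From mathcomp Require Import all_boot all_order all_algebra.
From mathcomp Require Import all_classical all_reals all_analysis.
From mathcomp Require Import ring lra.

(* X1 and X2 lie in a nine-dimensional Lie algebra of vector fields, the sum of
   sl2 in v1, of the Euclidean algebra e(2) in (v2, x, y) and of sl2 in v3; it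
   is modelled on 3 x 3 matrices: row i is the i-th summand, with basis E, C, S.
   On the i-th summand, the components x1, x2, x3 of X1, X2, X3 satisfy
     [x1, x2] = x3,   [x1, x3] = k_i x2,   [x2, x3] = m_i x1,
   so every iterated bracket is x1, x2 or x3 scaled summand-wise by a polynomial
   in k and m.  Linear independence thus reduces to small determinants in the
   values k_i, m_i.  A summand degenerates (x1 and x3 become proportional) when
   k_i = 0; then all the fields lie in the hyperplane E = C of that summand,
   which is a subalgebra.  So it suffices to find as many independent brackets
   as the dimension of the whole algebra or of this hyperplane, except in
   branch 1, where the relations are explicit. *)

Set Implicit Arguments.
Unset Strict Implicit.
Unset Printing Implicit Defensive.

Import Order.TTheory GRing.Theory Num.Theory.
Import numFieldNormedType.Exports.
Local Open Scope classical_set_scope.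
Local Open Scope ring_scope.

(** The cases are stated with the ring numerals, so that facts such as [be 1 = 0] rewrite
    syntactically in them. *)
Lemma ord3_ind (P : 'I_3 -> Prop) : P 0 -> P 1 -> P 2 -> forall i, P i.
Proof.
move=> P0 P1 P2 -[[|[|[|//]]] hi]; [move: P0|move: P1|move: P2];
  by congr P; apply: val_inj.
Qed.

(** * Fields with trigonometric components *)

Section TrigFields.
Variable R : realType.
Implicit Types (u v w : 'M[R]_3) (p : 'rV[R]_5).

(** For fixed [j] this family is stable under every partial derivative, so smoothness and brackets
    become computations with coefficients. *)
Definition trig (j : 'I_5) (c a b : R) (p : 'rV[R]_5) : R :=
  c + a * cos (p 0 j) + b * sin (p 0 j).

Lemma is_derive_trig (j k : 'I_5) (c a b : R) (p : 'rV[R]_5) :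
  is_derive p (delta_mx 0 k) (trig j c a b)
    (trig j 0 ((k == j)%:R * b) (- ((k == j)%:R * a)) p).
Proof.
have D : is_derive (p 0 j) 1 (fun x : R => c + a * cos x + b * sin x)
    (b * cos (p 0 j) - a * sin (p 0 j)).
  apply: is_derive_eq.
  by rewrite /GRing.scale /= add0r mul1r mulrN addrC.
have [->|nkj] := eqVneq k j; last first.
  (* In a direction other than [j] the function is constant, so the difference quotient vanishes
     identically. *)
  have E : (fun h : R => h^-1 *: ((trig j c a b \o shift p) (h *: delta_mx 0 k)
      - trig j c a b p)) = cst 0.
    apply/funext => h /=; rewrite /trig !mxE eqxx /= eq_sym (negbTE nkj).
    by rewrite mulr0 add0r subrr scaler0.
  have -> : trig j 0 (false%:R * b) (- (false%:R * a)) p = 0.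
    by rewrite /trig !mul0r oppr0 !mul0r !addr0.
  split; first by rewrite /derivable E; exact: is_cvg_cst.
  by rewrite /derive E; exact: lim_cst.
(* In direction [j] the difference quotient is that of the one-variable function differentiated in
   [D]. *)
have E : (fun h : R => h^-1 *: ((trig j c a b \o shift p) (h *: delta_mx 0 j)
    - trig j c a b p)) =
   (fun h : R => h^-1 *: (((fun x : R => c + a * cos x + b * sin x)
     \o shift (p 0 j)) (h *: 1) - (c + a * cos (p 0 j) + b * sin (p 0 j)))).
  by apply/funext => h /=; rewrite /trig !mxE !eqxx.
have -> : trig j 0 (true%:R * b) (- (true%:R * a)) p =
    b * cos (p 0 j) - a * sin (p 0 j) by rewrite /trig !mul1r add0r mulNr.
case: D => D1 D2; split; first by rewrite /derivable E.
by rewrite /derive E.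
Qed.

Lemma partial_trig (j k : 'I_5) (c a b : R) :
  partial k (trig j c a b) = trig j 0 ((k == j)%:R * b) (- ((k == j)%:R * a)).
Proof.
by apply/funext => p; case: (is_derive_trig j k c a b p).
Qed.

Lemma continuous_trig (j : 'I_5) (c a b : R) : continuous (trig j c a b).
Proof.
move=> p; have cj : {for p, continuous (fun q : 'rV[R]_5 => q 0 j)}.
  exact: (@coord_continuous R 1 5 0 j p).
have cc : (fun q : 'rV[R]_5 => cos (q 0 j)) q @[q --> p] --> cos (p 0 j).
  by apply: continuous_comp; [exact: cj | exact: continuous_cos].
have cs : (fun q : 'rV[R]_5 => sin (q 0 j)) q @[q --> p] --> sin (p 0 j).
  by apply: continuous_comp; [exact: cj | exact: continuous_sin].
exact: (cvgD (cvgD (cvg_cst c) (cvgM (cvg_cst a) cc)) (cvgM (cvg_cst b) cs)).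
Qed.

Lemma smooth_trig (j : 'I_5) (c a b : R) : smooth (trig j c a b).
Proof.
move=> js; suff [c' [a' [b' ->]]] : exists c' a' b',
    foldr (@partial R) (trig j c a b) js = trig j c' a' b'.
  split; first exact: continuous_trig.
  by move=> k p; case: (is_derive_trig j k c' a' b' p).
elim: js => [|k js [c' [a' [b' IH]]]] /=; first by exists c, a, b.
by rewrite IH partial_trig; do 3 eexists.
Qed.

(* On the middle summand, E = - d/dv2, S = cos v2 d/dx + sin v2 d/dy and
   C = [E, S] = sin v2 d/dx - cos v2 d/dy. *)
Definition field_of u : vfield R := fun p =>
  \row_(i < 5) trig ([:: 0; 0; 2; 1; 1]`_i)
    ([:: u 0 0; - u 1 0; u 2 0; 0; 0]`_i)
    ([:: u 0 1; 0; u 2 1; u 1 2; - u 1 1]`_i)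
    ([:: u 0 2; 0; u 2 2; u 1 1; u 1 2]`_i) p.

Lemma component_field_of u i : component (field_of u) i =
  trig ([:: 0; 0; 2; 1; 1]`_i)
    ([:: u 0 0; - u 1 0; u 2 0; 0; 0]`_i)
    ([:: u 0 1; 0; u 2 1; u 1 2; - u 1 1]`_i)
    ([:: u 0 2; 0; u 2 2; u 1 1; u 1 2]`_i).
Proof. by apply/funext => p; rewrite /component mxE. Qed.

(* [E, C] = - S, [E, S] = C and [C, S] = tau i E: the value 0 of tau gives e(2),
   the value 1 gives sl2. *)
Definition tau (i : 'I_3) : R := (i != 1)%:R.

Definition sl2e2_br u v : 'M[R]_3 := \matrix_(i < 3, j < 3)
  [:: tau i * (u i 1 * v i 2 - u i 2 * v i 1);
      u i 0 * v i 2 - u i 2 * v i 0;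
      u i 1 * v i 0 - u i 0 * v i 1]`_j.

(** On the outer summands the quadratic terms collapse by [cos2sin2] and yield the constant
    coefficient, whence [tau i = 1]. The middle summand rotates at constant speed, so no quadratic
    term arises there. *)
Lemma field_of_br u v :
  field_of (sl2e2_br u v) = lie_bracket (field_of u) (field_of v).
Proof.
apply/funext => p; apply/rowP => i; rewrite mxE [RHS]mxE.
(* [J] is the only coordinate on which component [i] can depend; component [1] is constant and gets
   the dummy coordinate [0]. All summands with [j != J] vanish. *)
set J := [:: 0; 0; 2; 1; 1]`_i.
rewrite (bigD1 J) //= big1 ?addr0; last first.
  move=> j /negbTE jJ; rewrite !component_field_of !partial_trig -/J jJ /trig.
  by rewrite !mul0r oppr0 !mul0r !addr0 !mulr0 subrr.
rewrite !component_field_of !partial_trig -/J eqxx.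
case: i @J => -[|[|[|[|[|//]]]]] Hi; rewrite /= /trig !mxE /= /tau /=.
- have := cos2sin2 (p 0 0).
  set c := cos _; set s := sin _ => cs.
  ring: cs.
- ring.
- have := cos2sin2 (p 0 2).
  set c := cos _; set s := sin _ => cs.
  ring: cs.
- ring.
- ring.
Qed.

End TrigFields.

(** * Linearity and injectivity of the model map, periodicity of its values *)

Section FieldOf.
Variable R : realType.
Implicit Types u : 'M[R]_3.

Lemma field_of_is_linear : linear (@field_of R : 'M[R]_3 -> vfield R).
Proof.
move=> a u v; apply/funext => p; apply/rowP => i; rewrite !mxE.
by case: i => -[|[|[|[|[|//]]]]] Hi; rewrite /= /trig ?mxE; ring.
Qed.

HB.instance Definition _ := GRing.isLinear.Build R 'M[R]_3 (vfield R) _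
  (@field_of R) field_of_is_linear.

(** A function [c + a cos + b sin] is determined by its values at [0], [pi] and [pi / 2]; constant
    row vectors evaluate all components at these points at once. *)
Lemma field_of_inj : injective (@field_of R).
Proof.
apply: raddf_inj => u u0.
have E i p : field_of u p 0 i = 0 by rewrite u0 mxE.
have c0 i : field_of u 0 0 i = 0 by exact: E.
have c1 i := E i (const_mx pi); have c2 i := E i (const_mx (pi / 2)).
have Z a b c : [/\ a + b * 1 + c * 0 = 0, a + b * -1 + c * 0 = 0 &
    a + b * 0 + c * 1 = 0] -> [/\ a = 0, b = 0 & c = 0 :> R].
  move=> [h1 h2 h3]; split; lra.
move: c0 c1 c2.
rewrite /field_of /trig => c0 c1 c2.
have {}Z (i : 'I_5) : [/\ ([:: u 0 0; - u 1 0; u 2 0; 0; 0]`_i) = 0,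
    ([:: u 0 1; 0; u 2 1; u 1 2; - u 1 1]`_i) = 0 &
    ([:: u 0 2; 0; u 2 2; u 1 1; u 1 2]`_i) = 0].
  apply: Z; move: (c0 i) (c1 i) (c2 i); rewrite !mxE.
  by rewrite cos0 sin0 cospi sinpi cos_pihalf sin_pihalf.
have [/= u00 u01 u02] := Z 0; have [/= u20 u21 u22] := Z 2.
have [/= /eqP + _ _] := Z 1; rewrite oppr_eq0 => /eqP u10.
have [/= _ u12 u11] := Z 3.
by apply/matrixP => i j; rewrite mxE; move: i j; do 2!apply: ord3_ind.
Qed.

Lemma field_of_vector_fields u : vector_fields (field_of u).
Proof.
split=> [i|j p _]; first by rewrite component_field_of; exact: smooth_trig.
(* The boolean records whether the shifted coordinate is the one that the component depends on. *)
have P (x : R) (k : bool) : cos (x + 2 * pi * k%:R) = cos x /\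
    sin (x + 2 * pi * k%:R) = sin x.
  by case: k; rewrite ?mulr0 ?addr0 // mulr1 mulr_natl cosD2pi sinD2pi.
apply/rowP => i; rewrite !mxE /trig !mxE.
set k := [:: 0; 0; 2; 1; 1]`_i.
by have [-> ->] := P (p 0 k) (k == j).
Qed.
End FieldOf.

(** * Growth of a Lie algebra embedded in a larger space *)

Section LinSpan.
Variables (R : pzRingType) (V : lmodType R).
Implicit Types (A L : set V).

(** Linear subspaces as predicates, which also make sense in the infinite-dimensional space of
    vector fields. *)
Definition lin_closed L :=
  L 0 /\ forall (a : R) (x y : V), L x -> L y -> L (a *: x + y).

Lemma lin_span_closed A : lin_closed (lin_span A).
Proof.
split.
  by exists 0%N, (fun=> 0), (fun=> 0); split; [case | rewrite big_ord0].
move=> c _ _ [n [a [w [Aw ->]]]] [m [b [z [Az ->]]]].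
exists (n + m)%N,
  (fun i => match fintype.split i with inl j => c * a j | inr k => b k end),
  (fun i => match fintype.split i with inl j => w j | inr k => z k end).
split; first by move=> i; case: fintype.split.
rewrite big_split_ord /= scaler_sumr; congr (_ + _); apply: eq_bigr => i _.
  by rewrite (unsplitK (inl i)) scalerA.
by rewrite (unsplitK (inr i)).
Qed.

Lemma sub_lin_span A : A `<=` lin_span A.
Proof.
move=> x Ax; exists 1%N, (fun=> 1), (fun=> x); split=> //.
by rewrite big_ord1 scale1r.
Qed.

Lemma lin_span_min A L : lin_closed L -> A `<=` L -> lin_span A `<=` L.
Proof.
move=> [L0 LD] AL _ [n [a [w [Aw ->]]]].
elim/big_ind: _ => // [x y Lx Ly|i _]; first by rewrite -[x]scale1r; exact: LD.
by rewrite -[X in L X]addr0; apply: LD => //; exact: AL.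
Qed.

Lemma lin_spanS A B : A `<=` B -> lin_span A `<=` lin_span B.
Proof.
move=> AB; apply: lin_span_min; first exact: lin_span_closed.
by move=> x /AB; exact: sub_lin_span.
Qed.

End LinSpan.

Lemma lin_span_image {R : pzRingType} {U V : lmodType R} (f : {linear U -> V})
    (A : set U) : lin_span (f @` A) = f @` lin_span A.
Proof.
apply/seteqP; split.
- apply: lin_span_min.
  + have [s0 sD] := lin_span_closed A.
    split; first by exists 0; rewrite ?linear0.
    move=> a _ _ [x Ax <-] [y Ay <-]; exists (a *: x + y); first exact: sD.
    by rewrite linearP.
  + by move=> _ [x Ax <-]; exists x => //; exact: sub_lin_span.
- move=> _ [_ [n [a [w [Aw ->]]]] <-]; exists n, a, (f \o w).
  split; first by move=> i; exists (w i).
  by rewrite linear_sum; apply: eq_bigr => i _; rewrite linearZ.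
Qed.

(** * Spans and freeness in a finite-dimensional space and in its injective images *)

Section LinVect.
Variables (K : fieldType) (g : vectType K).
Implicit Types (U : {vspace g}) (s : seq g).

Lemma vspace_lin_closed U : lin_closed [set` U].
Proof.
by split=> [|a x y /= Ux Uy]; [exact: mem0v | rewrite /= memvD ?memvZ].
Qed.

Lemma lin_span_seq s : lin_span [set` s] = [set` << s >>%VS].
Proof.
apply/seteqP; split.
  apply: lin_span_min; first exact: vspace_lin_closed.
  by move=> x; exact: memv_span.
move=> x /= xs; exists (size s), (fun i => coord (in_tuple s) i x),
  (fun i => s`_i).
by split; [move=> i; exact: mem_nth | exact: coord_span].
Qed.

Lemma free_lin_free (V : lmodType K) (f : {linear g -> V}) s :
  injective f -> free s -> lin_free (map f s).
Proof.
move=> f_inj /(@freeP _ _ _ (in_tuple s)) fs a a0 i.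
(* Extending the coefficients by [0] to all of [nat] avoids casts between the index types of [s] and
   [map f s]. *)
pose c (k : nat) := if insub k is Some j then a j else 0.
have ca j : a j = c j by rewrite /c valK.
have {}a0 : \sum_(j < size s) c j *: s`_j = 0.
  apply: f_inj; rewrite linear0 -[RHS]a0 linear_sum.
  under [RHS]eq_bigr do rewrite ca.
  rewrite -[RHS](big_mkord xpredT (fun j => c j *: (map f s)`_j)) size_map.
  rewrite big_mkord; apply: eq_bigr => j _.
  by rewrite linearZ (nth_map 0).
by rewrite ca; have := fs (fun j => c j) a0 (cast_ord (size_map f s) i).
Qed.

(** With coefficients indexed by [nat], the sum over a concrete list unfolds to the scalars [c 0],
    [c 1], and so on. *)
Lemma free_seqP s :
  (forall c : nat -> K, \sum_(i < size s) c i *: s`_i = 0 ->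
     forall i, (i < size s)%N -> c i = 0) -> free s.
Proof.
move=> H; apply/(@freeP _ _ _ (in_tuple s)) => a a0 i.
pose c (k : nat) := if insub k is Some j then a j else 0.
have ca j : a j = c j by rewrite /c valK.
rewrite ca; apply: H => //; rewrite -[RHS]a0; apply: eq_bigr => j _.
by rewrite ca.
Qed.

Lemma free_dim_take s n : free s -> (n <= size s)%N -> \dim <<take n s>> = n.
Proof.
move=> fs ns; have : free (take n s).
  by move: fs; rewrite -{1}(cat_take_drop n s); exact: catl_free.
by rewrite /free => /eqP ->; rewrite size_takel.
Qed.

Lemma has_dim_image (V : lmodType K) (f : {linear g -> V}) U :
  injective f -> has_dim (f @` [set` U]) (\dim U).
Proof.
move=> f_inj; exists (map f (vbasis U)); first by rewrite size_map size_tuple.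
split; first by apply: free_lin_free => //; exact: basis_free (vbasisP U).
have -> : [set` map f (vbasis U)] = f @` [set` vbasis U].
  by apply/seteqP; split=> x /= => [/mapP[y yU ->]|[y yU <-]];
    [exists y | exact: map_f].
by rewrite lin_span_image lin_span_seq (span_basis (vbasisP U)).
Qed.

End LinVect.

(** * The flag generated by two elements of a Lie algebra *)

Section LieGrowth.
Variables (K : fieldType) (g : vectType K) (gb : g -> {linear g -> g}).
Hypothesis gbN : forall x y, gb x y = - gb y x.
Hypothesis gbJ : forall x y z, gb (gb x y) z = gb x (gb y z) - gb y (gb x z).
Variables x1 x2 : g.

Definition bracket_step (U : {vspace g}) : {vspace g} :=
  (U + linfun (gb x1) @: U + linfun (gb x2) @: U)%VS.

(** [flag i] is D^{i+1}, with the same shift of index as [gspan]. *)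
Definition flag (i : nat) : {vspace g} :=
  iter i bracket_step <<[:: x1; x2]>>%VS.

Lemma bracket_step_span (s : seq g) : bracket_step << s >>%VS =
  << s ++ map (gb x1) s ++ map (gb x2) s>>%VS.
Proof.
rewrite /bracket_step !limg_span !span_cat addvA.
by congr (_ + _ + _)%VS; congr <<_>>%VS; apply: eq_map => x; rewrite lfunE.
Qed.

Lemma bracket_step_mem (U : {vspace g}) x : x \in [:: x1; x2] ->
  forall y, y \in U -> gb x y \in bracket_step U.
Proof.
move=> xx y yU; have E z : gb z y = linfun (gb z) y by rewrite lfunE.
move: xx; rewrite !inE => /orP[] /eqP ->; rewrite E.
  apply: (subvP (addvSl _ _)); apply: (subvP (addvSr _ _)).
  exact: memv_img.
by apply: (subvP (addvSr _ _)); exact: memv_img.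
Qed.

Lemma bracket_stepS (U : {vspace g}) : (U <= bracket_step U)%VS.
Proof. by rewrite /bracket_step -addvA addvSl. Qed.

(** Induction principle for right-normed brackets. [L] is a mere predicate so that it can express
    stability of a subspace or membership in a preimage. *)
Lemma flag_ind (L : set g) : lin_closed L -> L x1 -> L x2 ->
  (forall x y, x \in [:: x1; x2] -> L y -> L (gb x y)) ->
  forall i, [set` flag i] `<=` L.
Proof.
move=> Llin L1 L2 Lb; elim=> [|i IH] /=.
  rewrite -lin_span_seq; apply: lin_span_min => // x /=.
  by rewrite !inE => /orP[] /eqP ->.
have LD x y : L x -> L y -> L (x + y).
  by move=> Lx Ly; rewrite -[x]scale1r; exact: Llin.2.
move=> _ /= /memv_addP[_ /memv_addP[u uU [_ /memv_imgP[v vU ->] ->]]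
  [_ /memv_imgP[w wU ->] ->]].
rewrite !lfunE /=; apply: (LD); first apply: (LD); first exact: IH.
- by apply: Lb; rewrite ?inE ?eqxx //; exact: IH.
- by apply: Lb; rewrite ?inE ?eqxx ?orbT //; exact: IH.
Qed.

(** The elements [u] whose bracket operator preserves [U] form a linear space that contains the
    generators and is stable under bracketing with them. Hence a stationary flag is a subalgebra. *)
Lemma flag_closed (U : {vspace g}) : (bracket_step U <= U)%VS ->
  forall i u v, u \in flag i -> v \in U -> gb u v \in U.
Proof.
move=> UU i u v ui; move: v; move: i u ui; apply: flag_ind.
(* [gb x] is bundled as linear in its second argument only; antisymmetry carries this over to the
   first. *)
- split=> [v _|a x y Lx Ly v vU]; first by rewrite gbN linear0 oppr0 mem0v.
  rewrite gbN linearP opprD -scalerN -!gbN memvD ?memvZ ?Lx ?Ly //.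
- by move=> v vU; apply: (subvP UU); apply: bracket_step_mem;
    rewrite ?inE ?eqxx.
- by move=> v vU; apply: (subvP UU); apply: bracket_step_mem;
    rewrite ?inE ?eqxx ?orbT.
(* By the Jacobi identity the operator of [gb x y] is the commutator of those of [x] and [y], both
   of which preserve [U]. *)
- move=> x y xx Ly v vU; have xU w : w \in U -> gb x w \in U.
    by move=> wU; apply: (subvP UU); apply: bracket_step_mem.
  by rewrite gbJ rpredB ?xU ?Ly // xU.
Qed.

Lemma gspan_flag i :
  gspan (fun x y => gb x y) [set x1; x2] i = [set` flag i].
Proof.
rewrite /gspan; set d := [set x1; x2].
have dP x : d x <-> x \in [:: x1; x2].
  rewrite !inE; split=> [[->|->]|/orP[]/eqP ->]; rewrite ?eqxx ?orbT //.
    by left.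
  by right.
elim: i => [|i IH] /=.
  by rewrite -lin_span_seq; congr lin_span; apply/seteqP; split=> x /dP.
have Ds := @sub_lin_span _ _ (gset (fun x y => gb x y) d i).
apply/seteqP; split.
  apply: lin_span_min; first exact: vspace_lin_closed.
  move=> z [/Ds|[x [y [/dP dx /Ds gy ->]]]].
    by rewrite IH /=; apply/subvP; exact: bracket_stepS.
  by apply: bracket_step_mem => //; move: gy; rewrite IH.
set L := lin_span _.
have Llin : lin_closed L by exact: lin_span_closed.
have LD x y : L x -> L y -> L (x + y).
  by move=> Lx Ly; rewrite -[x]scale1r; exact: Llin.2.
have sub : [set` flag i] `<=` L by rewrite -IH; apply: lin_spanS => z; left.
(* [gset] only brackets with single elements. For fixed [x], the [w] with [L (gb x w)] form a linear
   space, so the property passes from [gset] to its span. *)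
have Lb x w : x \in [:: x1; x2] -> w \in flag i -> L (gb x w).
  move=> /dP dx wi; have : [set` flag i] w by [].
  rewrite -IH; move: w {wi}; apply: lin_span_min => [|z gz].
    split=> [|a y z Ly Lz]; first by rewrite linear0; exact: Llin.1.
    by rewrite linearP; exact: Llin.2.
  by apply: sub_lin_span; right; exists x, z.
move=> _ /= /memv_addP[_ /memv_addP[u uU [_ /memv_imgP[v vU ->] ->]]
  [_ /memv_imgP[w wU ->] ->]].
rewrite !lfunE /=; apply: (LD); first apply: (LD); first exact: sub.
- by apply: Lb => //; rewrite ?inE ?eqxx.
- by apply: Lb => //; rewrite ?inE ?eqxx ?orbT.
Qed.

(** * Flags in terms of named iterated brackets *)

Section Generators.
Variables x3 x4 x5 x14 x25 x114 x214 x125 x225 x1114 : g.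

(** The bracket table as one tuple of equations, so that [!brE] rewrites with all of them. *)
Hypothesis brE : ((gb x1 x1 = 0) * (gb x2 x2 = 0) * (gb x1 x2 = x3) *
  (gb x2 x1 = - x3) * (gb x1 x3 = x4) * (gb x2 x3 = x5) * (gb x1 x4 = x14) *
  (gb x2 x4 = 0) * (gb x1 x5 = 0) * (gb x2 x5 = x25) * (gb x1 x14 = x114) *
  (gb x2 x14 = x214) * (gb x1 x25 = x125) * (gb x2 x25 = x225) *
  (gb x1 x114 = x1114))%type.

Local Ltac span_mem :=
  rewrite /= ?mem0v ?memvN ?memvD ?memvZ ?memv_span ?inE ?eqxx ?orbT.

Lemma span_eq_mem (s t : seq g) : all [in <<t>>%VS] s ->
  all [in << s >>%VS] t -> << s >>%VS = <<t>>%VS.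
Proof.
move=> /allP st /allP ts; apply: subv_anti.
by apply/andP; split; apply/span_subvP.
Qed.

Lemma flag1 : flag 1 = <<[:: x1; x2; x3]>>%VS.
Proof.
by rewrite /= bracket_step_span /= !brE; apply: span_eq_mem; span_mem.
Qed.

Lemma flag2 : flag 2 = <<[:: x1; x2; x3; x4; x5]>>%VS.
Proof.
rewrite [LHS](congr1 bracket_step flag1) bracket_step_span /= !brE.
by apply: span_eq_mem; span_mem.
Qed.

Lemma flag3 : flag 3 = <<[:: x1; x2; x3; x4; x5; x14; x25]>>%VS.
Proof.
rewrite [LHS](congr1 bracket_step flag2) bracket_step_span /= !brE.
by apply: span_eq_mem; span_mem.
Qed.

Lemma flag4 :
  flag 4 = <<[:: x1; x2; x3; x4; x5; x14; x25; x114; x214; x125; x225]>>%VS.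
Proof.
rewrite [LHS](congr1 bracket_step flag3) bracket_step_span /= !brE.
by apply: span_eq_mem; span_mem.
Qed.

(** The situation of branches 1 to 3, where the fourth entry of the growth vector is 6 instead of
    7. *)
Lemma flag3_dep : x25 \in <<[:: x1; x2; x3; x4; x5; x14]>>%VS ->
  flag 3 = <<[:: x1; x2; x3; x4; x5; x14]>>%VS.
Proof.
by move=> dep; rewrite flag3; apply: span_eq_mem; rewrite /= ?dep; span_mem.
Qed.

Lemma flag4_dep : x25 \in <<[:: x1; x2; x3; x4; x5; x14]>>%VS ->
  flag 4 = <<[:: x1; x2; x3; x4; x5; x14; x114; x214]>>%VS.
Proof.
move=> dep.
have dep' : x25 \in <<[:: x1; x2; x3; x4; x5; x14; x114; x214]>>%VS.
  move: dep; apply/subvP; apply/span_subvP => x xs; apply: memv_span; move: xs.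
  by rewrite !inE => /or4P[| | |/or3P[]] /eqP ->; rewrite eqxx ?orbT.
rewrite [LHS](congr1 bracket_step (flag3_dep dep)) bracket_step_span /= !brE.
by apply: span_eq_mem; rewrite /= ?dep'; span_mem.
Qed.

(** Membership suffices: in branch 3 a dimension count identifies [flag 5], and brackets outside the
    table stay unevaluated. *)
Lemma flag5_dep : x25 \in <<[:: x1; x2; x3; x4; x5; x14]>>%VS ->
  x1114 \in flag 5.
Proof.
move=> dep; rewrite [flag 5](congr1 bracket_step (flag4_dep dep)).
by rewrite bracket_step_span /= !brE; span_mem.
Qed.

Lemma span6_closed x u :
  all [in <<[:: x1; x2; x3; x4; x5; x14]>>%VS] [:: x25; x114; x214] ->
  x \in [:: x1; x2] -> u \in <<[:: x1; x2; x3; x4; x5; x14]>>%VS ->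
  gb x u \in <<[:: x1; x2; x3; x4; x5; x14]>>%VS.
Proof.
move=> /and4P[H25 H114 H214 _] xx uU.
have := bracket_step_mem xx uU; apply/subvP.
rewrite bracket_step_span /= !brE.
apply/span_subvP/allP; rewrite /= H25 H114 H214; span_mem => //.
Qed.

End Generators.

(** * Transport of the flag along an injective bracket morphism *)

Variables (V : lmodType K) (br : V -> V -> V) (G : set V).
Variable f : {linear g -> V}.
Hypothesis f_inj : injective f.
Hypothesis f_br : forall x y, f (gb x y) = br (f x) (f y).
Hypothesis f_G : forall x, G (f x).
Local Notation d := [set f x1; f x2].

Lemma gspan_image i : gspan br d i = f @` [set` flag i].
Proof.
rewrite -gspan_flag /gspan -lin_span_image; congr lin_span.
elim: i => [|i IH] /=; first by rewrite image_setU !image_set1.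
rewrite image_setU IH; congr (_ `|` _); apply/seteqP; split=> z.
  move=> [x [_ [dx [y gy <-] ->]]].
  have [x' dx' <-] : (f @` [set x1; x2]) x by rewrite image_setU !image_set1.
  by rewrite -f_br; exists (gb x' y) => //; exists x', y.
move=> [_ [x [y [dx gy ->]]] <-]; exists (f x), (f y); rewrite f_br; split=> //.
  by case: dx => ->; [left | right].
by exists y.
Qed.

(** Each term of the flag is spanned by a prefix of the free list [s], so its dimension is read off
    from [gv]; stability of the last term makes it the generated subalgebra. *)
Lemma growth_of_flag (s : seq g) (gv : seq nat) :
  free s -> (0 < size gv)%N ->
  [&& sorted ltn gv, all (fun n => n <= size s)%N gv & last 0%N gv == size s] ->
  (forall i, (i < size gv)%N -> flag i = <<take (nth 0%N gv i) s>>%VS) ->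
  (bracket_step << s >> <= << s >>)%VS ->
  [/\ lie_subalgebra br G (lie_generated br G d),
      is_basis (lie_generated br G d) (map f s) & growth_vector br d gv].
Proof.
move=> fs gv0 /and3P[gvS /allP gvs /eqP gvl] flagE stepU.
have flagU : flag (size gv).-1 = << s >>%VS.
  by rewrite flagE ?prednK // nth_last gvl take_size.
have dimE i : (i < size gv)%N -> \dim (flag i) = nth 0%N gv i.
  by move=> ig; rewrite flagE // free_dim_take // gvs // mem_nth.
have dE x : d x -> exists2 y, y \in [:: x1; x2] & x = f y.
  by case=> ->; [exists x1 | exists x2]; rewrite ?inE ?eqxx ?orbT.
have UG : lie_subalgebra br G (f @` [set` << s >>%VS]).
  split=> [_ [x _ <-] //||a _ _ [x xs <-] [y ys <-]|_ _ [x xs <-] [y ys <-]].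
  - by exists 0; [exact: mem0v | rewrite linear0].
  - by exists (a *: x + y); [rewrite /= memvD ?memvZ | rewrite linearP].
  - exists (gb x y); last by rewrite f_br.
    by apply: (flag_closed stepU (i := (size gv).-1)) => //; rewrite flagU.
have sE : lie_generated br G d = f @` [set` << s >>%VS].
  apply/seteqP; split.
    apply: smallest_sub => // x /dE [y yx ->]; exists y => //=.
    rewrite -flagU; elim: (_.-1) => [|i IH] /=; first exact: memv_span.
    by apply: (subvP (bracket_stepS _)).
  rewrite -flagU => _ [x xi <-] L [[LG L0 Llin Lbr] dL].
  (* The preimage under [f] of any competing subalgebra is linear and stable under the generators,
     hence contains the flag. *)
  move: x xi; apply: (flag_ind (L := [set x | L (f x)])) => /=.
  - split=> [|a x y Lx Ly]; rewrite /= ?linear0 ?linearP //; exact: Llin.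
  - by apply: dL; left.
  - by apply: dL; right.
  - move=> x y xx Ly; rewrite f_br; apply: Lbr => //; apply: dL.
    by move: xx; rewrite !inE => /orP[] /eqP ->; [left | right].
split; rewrite ?sE //.
  split; first exact: free_lin_free.
  have -> : [set` map f s] = f @` [set` s].
    by apply/seteqP; split=> x /= => [/mapP[y yU ->]|[y yU <-]];
      [exists y | exact: map_f].
  by rewrite lin_span_image lin_span_seq.
split=> //.
- rewrite !gspan_image; congr image; congr mkset.
  have -> : flag (size gv) = bracket_step (flag (size gv).-1).
    by rewrite -[X in flag X](prednK gv0).
  rewrite flagU; congr pred_of_vspace.
  by apply: subv_anti; rewrite stepU bracket_stepS.
(* Equal consecutive terms would have equal dimensions, against the strict increase of [gv]. *)
- move=> i ig; rewrite !gspan_image => E.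
  have {}E : flag i = flag i.+1.
    apply/vspaceP => x; apply/idP/idP => xi.
      have [y yi /f_inj <- //] : (f @` [set` flag i.+1]) (f x).
      by rewrite -E; exists x.
    have [y yi /f_inj <- //] : (f @` [set` flag i]) (f x).
    by rewrite E; exists x.
  have := sorted_ltn_nth ltn_trans 0%N gvS i i.+1.
  rewrite !inE (ltnW ig) ig -!dimE ?(ltnW ig) // E ltnn.
  by move/(_ isT isT (ltnSn i)).
- by move=> i ig; rewrite gspan_image -dimE //; exact: has_dim_image.
Qed.

(** Sandwich: the span of [s] lies in the last flag term, which lies in [W], and the dimension bound
    forces equality. So the last term need only be shown to contain [s], and its stability is
    inherited from [W]. *)
Lemma growth_of_flag_in (W : {vspace g}) (s : seq g) (gv : seq nat) :
  free s -> (0 < size gv)%N ->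
  [&& sorted ltn gv, all (fun n => n <= size s)%N gv & last 0%N gv == size s] ->
  (forall i, (i < (size gv).-1)%N -> flag i = <<take (nth 0%N gv i) s>>%VS) ->
  all [in flag (size gv).-1] s -> (\dim W <= size s)%N ->
  x1 \in W -> x2 \in W ->
  (forall u, u \in W -> gb x1 u \in W) ->
  (forall u, u \in W -> gb x2 u \in W) ->
  [/\ lie_subalgebra br G (lie_generated br G d),
      is_basis (lie_generated br G d) (map f s) & growth_vector br d gv].
Proof.
move=> fs gv0 gvs flagE /allP sflag dimW W1 W2 W1b W2b.
have flagW i : (flag i <= W)%VS.
  apply/subvP; apply: flag_ind => // [|x y]; first exact: vspace_lin_closed.
  by rewrite !inE => /orP[] /eqP -> /=; [exact: W1b | exact: W2b].
have sF : (<< s >> <= flag (size gv).-1)%VS by apply/span_subvP.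
have sW : << s >>%VS = W.
  apply/eqP; rewrite eqEdim (subv_trans sF) //=.
  by move: fs; rewrite /free => /eqP ->.
apply: growth_of_flag => // [i igv|]; last first.
  rewrite sW /bracket_step !subv_add subvv /=.
  by apply/andP; split; apply/subvP => _ /memv_imgP[u uW ->]; rewrite lfunE;
    [exact: W1b | exact: W2b].
have [|gvi] := ltnP i (size gv).-1; first exact: flagE.
have -> : i = (size gv).-1.
  by apply/eqP; rewrite eqn_leq gvi -ltnS prednK // igv.
case/and3P: gvs => _ _ /eqP gvl; rewrite nth_last gvl take_size.
by apply: subv_anti; rewrite sF sW flagW.
Qed.

End LieGrowth.

(** * The model of X1 and X2 *)

Section Model.
Variable R : realType.
Implicit Types (u v w : 'M[R]_3).

Lemma matrix3P u v :
  (forall i, [/\ u i 0 = v i 0, u i 1 = v i 1 & u i 2 = v i 2]) -> u = v.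
Proof. by move=> uv; apply/matrixP => i; have [] := uv i; exact: ord3_ind. Qed.

Lemma sl2e2_br_is_linear u : linear (sl2e2_br u).
Proof.
move=> a v w; apply: matrix3P => i; rewrite !mxE /=; split; ring.
Qed.

HB.instance Definition _ u := GRing.isLinear.Build R 'M[R]_3 'M[R]_3 _
  (sl2e2_br u) (sl2e2_br_is_linear u).

Definition sl2e2 u : {linear 'M[R]_3 -> 'M[R]_3} := sl2e2_br u.

Lemma sl2e2N u v : sl2e2 u v = - sl2e2 v u.
Proof. by apply: matrix3P => i; rewrite !mxE /=; split; ring. Qed.

Lemma sl2e2J u v w :
  sl2e2 (sl2e2 u v) w = sl2e2 u (sl2e2 v w) - sl2e2 v (sl2e2 u w).
Proof. by apply: matrix3P => i; rewrite !mxE /=; split; ring. Qed.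

Variables (be e : 'I_3 -> R).

(* x1, x2 and x3 with the i-th summand scaled by p i, q i and r i. *)
Definition T1 (p : 'I_3 -> R) : 'M[R]_3 :=
  \matrix_(i < 3, j < 3) [:: p i; be i * p i; 0]`_j.
Definition T2 (q : 'I_3 -> R) : 'M[R]_3 :=
  \matrix_(i < 3, j < 3) [:: 0; 0; e i * q i]`_j.
Definition T3 (r : 'I_3 -> R) : 'M[R]_3 :=
  \matrix_(i < 3, j < 3) [:: tau R i * be i * e i * r i; e i * r i; 0]`_j.

(* The constants k_i and m_i. *)
Definition kk i : R := tau R i * be i ^+ 2 - 1.
Definition mm i : R := - (tau R i * e i ^+ 2).

Lemma sl2e2_T11 p q : sl2e2 (T1 p) (T1 q) = 0.
Proof. by apply: matrix3P => i; rewrite !mxE /=; split; ring. Qed.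
Lemma sl2e2_T22 p q : sl2e2 (T2 p) (T2 q) = 0.
Proof. by apply: matrix3P => i; rewrite !mxE /=; split; ring. Qed.
Lemma sl2e2_T12 p q : sl2e2 (T1 p) (T2 q) = T3 (fun i => p i * q i).
Proof. by apply: matrix3P => i; rewrite !mxE /=; split; ring. Qed.
Lemma sl2e2_T13 p r : sl2e2 (T1 p) (T3 r) = T2 (fun i => kk i * p i * r i).
Proof. by apply: matrix3P => i; rewrite !mxE /= /kk; split; ring. Qed.
Lemma sl2e2_T23 q r : sl2e2 (T2 q) (T3 r) = T1 (fun i => mm i * q i * r i).
Proof. by apply: matrix3P => i; rewrite !mxE /= /mm; split; ring. Qed.

Definition x1 := T1 (fun=> 1).
Definition x2 := T2 (fun=> 1).
Definition x3 := T3 (fun=> 1).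
Definition x4 := T2 kk.
Definition x5 := T1 mm.
Definition x14 := T3 kk.
(** The sign comes from [[x2, x1] = - x3]. *)
Definition x25 := T3 (fun i => - mm i).
Definition x114 := T2 (fun i => kk i ^+ 2).
Definition x214 := T1 (fun i => mm i * kk i).
Definition x125 := T2 (fun i => - (kk i * mm i)).
Definition x225 := T1 (fun i => - mm i ^+ 2).
Definition x1114 := T3 (fun i => kk i ^+ 2).

Lemma br11 : sl2e2 x1 x1 = 0. Proof. exact: sl2e2_T11. Qed.
Lemma br22 : sl2e2 x2 x2 = 0. Proof. exact: sl2e2_T22. Qed.
Lemma br12 : sl2e2 x1 x2 = x3.
Proof. by rewrite sl2e2_T12; congr T3; apply/funext => i; ring. Qed.
Lemma br21 : sl2e2 x2 x1 = - x3.
Proof. by rewrite sl2e2N br12. Qed.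
Lemma br13 : sl2e2 x1 x3 = x4.
Proof. by rewrite sl2e2_T13; congr T2; apply/funext => i; ring. Qed.
Lemma br23 : sl2e2 x2 x3 = x5.
Proof. by rewrite sl2e2_T23; congr T1; apply/funext => i; ring. Qed.
Lemma br14 : sl2e2 x1 x4 = x14.
Proof. by rewrite sl2e2_T12; congr T3; apply/funext => i; ring. Qed.
Lemma br24 : sl2e2 x2 x4 = 0. Proof. exact: sl2e2_T22. Qed.
Lemma br15 : sl2e2 x1 x5 = 0. Proof. exact: sl2e2_T11. Qed.
Lemma br25 : sl2e2 x2 x5 = x25.
Proof.
by rewrite sl2e2N sl2e2_T12; apply: matrix3P => i; rewrite !mxE /=; split; ring.
Qed.
Lemma br114 : sl2e2 x1 x14 = x114.
Proof. by rewrite sl2e2_T13; congr T2; apply/funext => i; ring. Qed.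
Lemma br214 : sl2e2 x2 x14 = x214.
Proof. by rewrite sl2e2_T23; congr T1; apply/funext => i; ring. Qed.
Lemma br125 : sl2e2 x1 x25 = x125.
Proof. by rewrite sl2e2_T13; congr T2; apply/funext => i; ring. Qed.
Lemma br225 : sl2e2 x2 x25 = x225.
Proof. by rewrite sl2e2_T23; congr T1; apply/funext => i; ring. Qed.
Lemma br1114 : sl2e2 x1 x114 = x1114.
Proof. by rewrite sl2e2_T12; congr T3; apply/funext => i; ring. Qed.
(** The order is that of the abstract table [brE] in the section on flags. *)
Definition sl2e2_brE := (br11, br22, br12, br21, br13, br23, br14, br24, br15,
  br25, br114, br214, br125, br225, br1114).

(** On the middle summand [T1], [T2], [T3] occupy different columns and separate at once; on the
    outer ones [T1] and [T3] share the columns E and C. *)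
Lemma T_eq0 (p q r : 'I_3 -> R) : be 1 = 0 -> (forall i, e i != 0) ->
  T1 p + T2 q + T3 r = 0 ->
  [/\ p 1 = 0, q 1 = 0, r 1 = 0 & forall i, i != 1 ->
    [/\ q i = 0, p i + be i * e i * r i = 0 & be i * p i + e i * r i = 0]].
Proof.
move=> be1 e0 /matrixP E.
have E0 i : p i + tau R i * be i * e i * r i = 0.
  by have := E i 0; rewrite !mxE /= addr0.
have E1 i : be i * p i + e i * r i = 0.
  by have := E i 1; rewrite !mxE /= addr0.
have E2 i : q i = 0.
  by have := E i 2; rewrite !mxE /= add0r addr0 => /eqP;
     rewrite mulf_eq0 (negbTE (e0 i)) => /eqP.
split=> //.
- by have := E0 1; rewrite be1 mulr0 !mul0r addr0.
- have /eqP := E1 1; rewrite be1 !mul0r add0r mulf_eq0 (negbTE (e0 1)).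
  by move/eqP.
- by move=> i i1; have := E0 i; rewrite /tau i1 mul1r.
Qed.

End Model.

(** * Linear independence *)

Section Branches.
Variable R : realType.
Variables (be e : 'I_3 -> R).
Hypothesis be1 : be 1 = 0.
Hypothesis e0 : forall i, e i != 0.

Local Notation x1 := (x1 be).
Local Notation x2 := (x2 e).
Local Notation x3 := (x3 be e).
Local Notation x4 := (x4 be e).
Local Notation x5 := (x5 be e).
Local Notation x14 := (x14 be e).
Local Notation x25 := (x25 be e).
Local Notation x114 := (x114 be e).
Local Notation x214 := (x214 be e).
Local Notation x125 := (x125 be e).
Local Notation x225 := (x225 be e).
Local Notation x1114 := (x1114 be e).
Local Notation kk := (kk be).
Local Notation mm := (mm e).

(** The system for [p i] and [r i] on an outer summand has determinant [- e i * kk i]. If [kk i = 0]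
    only the one displayed relation survives. *)
Definition coef_eqs (p q r : 'I_3 -> R) :=
  [/\ p 1 = 0, q 1 = 0, r 1 = 0 & forall i, i != 1 ->
    [/\ q i = 0, p i + be i * e i * r i = 0 & kk i != 0 -> p i = 0 /\ r i = 0]].

Lemma T_split (p q r : 'I_3 -> R) :
  T1 be p + T2 e q + T3 be e r = 0 -> coef_eqs p q r.
Proof.
move=> /(T_eq0 be1 e0)[p1 q1 r1 H]; split=> // i i1; have [-> E0 E1] := H i i1.
split=> //; rewrite /kk /tau i1 mul1r => k0.
have p0 : p i = 0.
  have : (be i ^+ 2 - 1) * p i = 0.
    by transitivity (be i * (be i * p i + e i * r i) -
      (p i + be i * e i * r i)); [ring | rewrite E0 E1; ring].
  by move/eqP; rewrite mulf_eq0 (negbTE k0) => /eqP.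
split=> //; move/eqP: E1; rewrite p0 mulr0 add0r mulf_eq0 (negbTE (e0 i)).
by move/eqP.
Qed.

Lemma kk1 : kk 1 = -1. Proof. by rewrite /kk /tau eqxx mul0r add0r. Qed.
Lemma mm1 : mm 1 = 0. Proof. by rewrite /mm /tau eqxx mul0r oppr0. Qed.

Lemma mm_neq0 i : i != 1 -> mm i != 0.
Proof. by move=> i1; rewrite /mm /tau i1 mul1r oppr_eq0 expf_neq0. Qed.

Lemma det2_eq0 (a b c d x y : R) : a * d - b * c != 0 ->
  a * x + b * y = 0 -> c * x + d * y = 0 -> x = 0 /\ y = 0.
Proof.
move=> D E F; split; apply/eqP; rewrite -(mulrI_eq0 _ (mulfI D)); apply/eqP.
  by transitivity (d * (a * x + b * y) - b * (c * x + d * y));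
    [ring | rewrite E F; ring].
by transitivity (a * (c * x + d * y) - c * (a * x + b * y));
    [ring | rewrite E F; ring].
Qed.

(** A polynomial of degree at most two with three distinct roots is zero. *)
Lemma quadratic_eq0 (a b c x y z : R) : a != b -> a != c -> b != c ->
  x + y * a + z * a ^+ 2 = 0 -> x + y * b + z * b ^+ 2 = 0 ->
  x + y * c + z * c ^+ 2 = 0 -> [/\ x = 0, y = 0 & z = 0].
Proof.
move=> ab ac bc A B C.
have AB : 1 * y + (a + b) * z = 0.
  apply: (mulfI (x := a - b)); rewrite ?subr_eq0 // mulr0.
  by transitivity ((x + y * a + z * a ^+ 2) - (x + y * b + z * b ^+ 2));
    [ring | rewrite A B subrr].
have AC : 1 * y + (a + c) * z = 0.
  apply: (mulfI (x := a - c)); rewrite ?subr_eq0 // mulr0.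
  by transitivity ((x + y * a + z * a ^+ 2) - (x + y * c + z * c ^+ 2));
    [ring | rewrite A C subrr].
have [|y0 z0] := det2_eq0 _ AB AC.
  by rewrite (_ : _ - _ = c - b); [rewrite subr_eq0 eq_sym | ring].
by split=> //; move: A; rewrite y0 z0 !mul0r !addr0.
Qed.

Lemma cancel0 (x y : R) : y != 0 -> x * y = 0 -> x = 0.
Proof. by move=> y0 /eqP; rewrite mulf_eq0 (negbTE y0) orbF => /eqP. Qed.

(** [p], [q], [r] collect a linear combination by type: multiples of [x1], [x2], [x3] on each
    summand. *)
Lemma free_T (s : seq 'M[R]_3) (p q r : (nat -> R) -> 'I_3 -> R) :
  (forall c : nat -> R, \sum_(i < size s) c i *: s`_i =
     T1 be (p c) + T2 e (q c) + T3 be e (r c)) ->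
  (forall c, coef_eqs (p c) (q c) (r c) ->
     forall i, (i < size s)%N -> c i = 0) -> free s.
Proof.
by move=> E H; apply: free_seqP => c; rewrite E => /T_split; exact: H.
Qed.

Ltac expand_T :=
  let c := fresh in let i := fresh in
  move=> c; rewrite !big_ord_recr big_ord0 /=; apply: matrix3P => i;
  rewrite /x1 /x2 /x3 /x4 /x5 /x14 /x25 /x114 /x214 /x125 /x225 /x1114 !mxE /=;
  split; ring.

(** The middle summand has [k = -1] and [m = 0]; comparing it with summand [0], where [k != -1] and
    [m != 0], kills all pairs of coefficients. *)
Lemma free_branch1a : kk 0 = kk 2 -> kk 0 != 0 -> kk 0 != -1 ->
  free [:: x1; x2; x3; x4; x5; x14].
Proof.
move=> k02 n0 k0.
apply: (free_T (p := fun c i => c 0%N + c 4%N * mm i)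
  (q := fun c i => c 1%N + c 3%N * kk i)
  (r := fun c i => c 2%N + c 5%N * kk i)); first expand_T.
move=> c []; rewrite kk1 mm1 => p1 q1 r1 H.
have [q0 _ /(_ n0)[p0 r0]] := H 0 isT.
have k0' : kk 0 + 1 != 0 by rewrite addr_eq0.
have c4 : c 4%N = 0 by apply: (cancel0 (mm_neq0 (i := 0) isT)); lra.
have c3 : c 3%N = 0 by apply: (cancel0 k0'); lra.
have c5 : c 5%N = 0 by apply: (cancel0 k0'); lra.
have c0 : c 0%N = 0 by lra.
have c1 : c 1%N = 0 by lra.
have c2 : c 2%N = 0 by lra.
by do 6?[case=> //].
Qed.

(** Both outer summands degenerate and leave [c 2 = e i * c 4] each; the two values of [e]
    differ. *)
Lemma free_branch1b : kk 0 = 0 -> kk 2 = 0 -> be 0 = 1 -> be 2 = 1 ->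
  e 0 != e 2 -> free [:: x1; x2; x3; x4; x5; x14].
Proof.
move=> k0 k2 b0 b2 e02.
apply: (free_T (p := fun c i => c 0%N + c 4%N * mm i)
  (q := fun c i => c 1%N + c 3%N * kk i)
  (r := fun c i => c 2%N + c 5%N * kk i)); first expand_T.
move=> c []; rewrite kk1 mm1 => p1 q1 r1 H.
have [q0 + _] := H 0 isT; have [_ + _] := H 2 isT.
rewrite /mm /tau /= k0 k2 b0 b2 => E2 E0; rewrite k0 in q0.
have c0 : c 0%N = 0 by lra.
have D0 : c 2%N = e 0 * c 4%N.
  apply/eqP; rewrite -subr_eq0; apply/eqP/(cancel0 (e0 0)); lra.
have D2 : c 2%N = e 2 * c 4%N.
  apply/eqP; rewrite -subr_eq0; apply/eqP/(cancel0 (e0 2)); lra.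
have c4 : c 4%N = 0.
  by apply: (@cancel0 _ (e 0 - e 2)); [rewrite subr_eq0 | lra].
have c2 : c 2%N = 0 by rewrite D0 c4 mulr0.
have c1 : c 1%N = 0 by lra.
have c3 : c 3%N = 0 by lra.
have c5 : c 5%N = 0 by lra.
by do 6?[case=> //].
Qed.

(** The [q] part is a quadratic in [k] with roots [-1], [0], [kk j]. The [r] part vanishes by the
    middle summand and [j], after which the degenerate relation on [i] yields [c 4 = 0]. *)
Lemma free_branch2 i j : i != 1 -> j != 1 -> kk i = 0 -> kk j != 0 ->
  kk j != -1 -> free [:: x1; x2; x3; x4; x5; x14; x114; x214].
Proof.
move=> i1 j1 ki nj kj.
apply: (free_T (p := fun c i => c 0%N + c 4%N * mm i + c 7%N * (mm i * kk i))
  (q := fun c i => c 1%N + c 3%N * kk i + c 6%N * kk i ^+ 2)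
  (r := fun c i => c 2%N + c 5%N * kk i)); first expand_T.
move=> c []; rewrite kk1 mm1 => p1 q1 r1 H.
have [qj _ /(_ nj)[pj rj]] := H j j1; have [qi + _] := H i i1.
have mj := mm_neq0 j1; have mi := mm_neq0 i1.
have kj' : kk j + 1 != 0 by rewrite addr_eq0.
rewrite ki in qi * => pi.
have c5 : c 5%N = 0 by apply: (cancel0 kj'); lra.
have c2 : c 2%N = 0 by lra.
have c0 : c 0%N = 0 by lra.
have c4 : c 4%N = 0.
  by apply: (cancel0 mi); rewrite -pi c0 c2 c5; ring.
have c7 : c 7%N = 0.
  by apply: (cancel0 nj); apply: (cancel0 mj); rewrite -pj c0 c4; ring.
have c1 : c 1%N = 0 by lra.
have c3 : c 3%N = 0.
  have c63 : c 6%N = c 3%N by lra.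
  by apply: (cancel0 kj'); apply: (cancel0 nj); rewrite -qj c1 c63; ring.
have c6 : c 6%N = 0 by lra.
by do 8?[case=> //].
Qed.

Lemma det_mk (x y : R) : kk 0 != kk 2 -> (x + y * kk 0) * mm 0 = 0 ->
  (x + y * kk 2) * mm 2 = 0 -> x = 0 /\ y = 0.
Proof.
move=> k02 /(cancel0 (mm_neq0 (i := 0) isT)) E
  /(cancel0 (mm_neq0 (i := 2) isT)) F.
have y0 : y = 0 by apply: (@cancel0 _ (kk 0 - kk 2)); [rewrite subr_eq0 | lra].
by split=> //; rewrite y0 in E; lra.
Qed.

(** Both [q] and [r] are quadratics in [k] vanishing at the distinct values [kk 0], [-1], [kk 2]. *)
Lemma free_branch3 : kk 0 != 0 -> kk 2 != 0 -> kk 0 != -1 -> kk 2 != -1 ->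
  kk 0 != kk 2 -> free [:: x1; x2; x3; x4; x5; x14; x114; x214; x1114].
Proof.
move=> n0 n2 k0 k2 k02.
apply: (free_T (p := fun c i => c 0%N + c 4%N * mm i + c 7%N * (mm i * kk i))
  (q := fun c i => c 1%N + c 3%N * kk i + c 6%N * kk i ^+ 2)
  (r := fun c i => c 2%N + c 5%N * kk i + c 8%N * kk i ^+ 2)); first expand_T.
move=> c []; rewrite kk1 mm1 => p1 q1 r1 H.
have [q0 _ /(_ n0)[p0 r0]] := H 0 isT; have [q2 _ /(_ n2)[p2 r2]] := H 2 isT.
have k2' : -1 != kk 2 by rewrite eq_sym.
have [c1 c3 c6] := quadratic_eq0 k0 k02 k2' q0 q1 q2.
have [c2 c5 c8] := quadratic_eq0 k0 k02 k2' r0 r1 r2.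
have c0 : c 0%N = 0 by lra.
have [||c4 c7] := @det_mk (c 4%N) (c 7%N) k02; [lra|lra|].
by do 9?[case=> //].
Qed.

(** Summand [j] and the middle one share [k = -1] and are told apart by [m]; the degenerate relation
    on [i] then settles [c 2]. *)
Lemma free_branch4 i j : i != 1 -> j != 1 -> kk i = 0 -> be i != 0 ->
  kk j = -1 -> free [:: x1; x2; x3; x4; x5; x14; x25; x125].
Proof.
move=> i1 j1 ki bi kj.
apply: (free_T (p := fun c i => c 0%N + c 4%N * mm i)
  (q := fun c i => c 1%N + c 3%N * kk i - c 7%N * (kk i * mm i))
  (r := fun c i => c 2%N + c 5%N * kk i - c 6%N * mm i)); first expand_T.
move=> c []; rewrite kk1 mm1 => p1 q1 r1 H.
have nj : kk j != 0 by rewrite kj oppr_eq0 oner_eq0.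
have [+ _ /(_ nj)[pj +]] := H j j1; have [qi pi _] := H i i1.
have mj := mm_neq0 j1; rewrite ki in qi pi; rewrite kj => qj rj.
have c0 : c 0%N = 0 by lra.
have c4 : c 4%N = 0 by apply: (cancel0 mj); lra.
have c7 : c 7%N = 0 by apply: (cancel0 mj); lra.
have c6 : c 6%N = 0 by apply: (cancel0 mj); lra.
have c1 : c 1%N = 0 by rewrite c7 in qi; lra.
have c3 : c 3%N = 0 by lra.
have c2 : c 2%N = 0.
  apply: (cancel0 (e0 i)); apply: (cancel0 bi); rewrite -pi c0 c4 c6; ring.
have c5 : c 5%N = 0 by lra.
by do 8?[case=> //].
Qed.

(** The outer summands share [k], so [m] separates them; the [p] part is a quadratic in [m] with
    roots [0], [mm 0], [mm 2]. *)
Lemma free_branch5 : kk 0 = kk 2 -> kk 0 != 0 -> kk 0 != -1 -> mm 0 != mm 2 ->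
  free [:: x1; x2; x3; x4; x5; x14; x25; x125; x225].
Proof.
move=> k02 n0 k0 m02.
apply: (free_T (p := fun c i => c 0%N + c 4%N * mm i - c 8%N * mm i ^+ 2)
  (q := fun c i => c 1%N + c 3%N * kk i - c 7%N * (kk i * mm i))
  (r := fun c i => c 2%N + c 5%N * kk i - c 6%N * mm i)); first expand_T.
move=> c []; rewrite kk1 mm1 => p1 q1 r1 H.
have n2 : kk 2 != 0 by rewrite -k02.
have [q0 _ /(_ n0)[p0 r0]] := H 0 isT; have [q2 _ /(_ n2)[p2 r2]] := H 2 isT.
rewrite -!k02 in q2 p2 r2.
have k0' : kk 0 + 1 != 0 by rewrite addr_eq0.
have m02' : mm 0 - mm 2 != 0 by rewrite subr_eq0.
have c0 : c 0%N = 0 by lra.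
have E : c 4%N - c 8%N * mm 0 = 0.
  by apply: (cancel0 (mm_neq0 (i := 0) isT)); lra.
have F : c 4%N - c 8%N * mm 2 = 0.
  by apply: (cancel0 (mm_neq0 (i := 2) isT)); lra.
have c8 : c 8%N = 0 by apply: (cancel0 m02'); lra.
have c4 : c 4%N = 0 by rewrite c8 in E; lra.
have c7 : c 7%N = 0 by apply: (cancel0 n0); apply: (cancel0 m02'); lra.
have c6 : c 6%N = 0 by apply: (cancel0 m02'); lra.
have c3 : c 3%N = 0 by apply: (cancel0 k0'); rewrite c7 in q0; lra.
have c5 : c 5%N = 0 by apply: (cancel0 k0'); rewrite c6 in r0; lra.
have c1 : c 1%N = 0 by lra.
have c2 : c 2%N = 0 by lra.
by do 9?[case=> //].
Qed.

(** The middle summand and [j] are compared through [m], then the middle summand and [i] through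
    [k]. *)
Lemma free_branch6 i j : i != 1 -> j != 1 -> kk i != 0 -> kk i != -1 ->
  kk j = -1 -> free [:: x1; x2; x3; x4; x5; x14; x25; x214; x125].
Proof.
move=> i1 j1 ni ki kj.
apply: (free_T (p := fun c i => c 0%N + c 4%N * mm i + c 7%N * (mm i * kk i))
  (q := fun c i => c 1%N + c 3%N * kk i - c 8%N * (kk i * mm i))
  (r := fun c i => c 2%N + c 5%N * kk i - c 6%N * mm i)); first expand_T.
move=> c []; rewrite kk1 mm1 => p1 q1 r1 H.
have nj : kk j != 0 by rewrite kj oppr_eq0 oner_eq0.
have [+ _ /(_ nj)[]] := H j j1; have [qi _ /(_ ni)[pi ri]] := H i i1.
have mj := mm_neq0 j1; have mi := mm_neq0 i1; rewrite kj => qj pj rj.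
have ki' : kk i + 1 != 0 by rewrite addr_eq0.
have c0 : c 0%N = 0 by lra.
have c47 : c 4%N = c 7%N.
  by apply/eqP; rewrite -subr_eq0; apply/eqP/(cancel0 mj); lra.
have c7 : c 7%N = 0.
  by apply: (cancel0 ki'); apply: (cancel0 mi); rewrite c47 in pi; lra.
have c4 : c 4%N = 0 by rewrite c47.
have c8 : c 8%N = 0 by apply: (cancel0 mj); lra.
have c6 : c 6%N = 0 by apply: (cancel0 mj); lra.
have c3 : c 3%N = 0 by apply: (cancel0 ki'); rewrite c8 in qi; lra.
have c5 : c 5%N = 0 by apply: (cancel0 ki'); rewrite c6 in ri; lra.
have c1 : c 1%N = 0 by lra.
have c2 : c 2%N = 0 by lra.
by do 9?[case=> //].
Qed.

(** The last hypothesis says that the points [(k, m)] of the three summands, one of them [(-1, 0)],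
    are not collinear; it is what kills [c 6]. *)
Lemma free_branch7 i j : i != 1 -> j != 1 -> kk i = 0 ->
  kk j != 0 -> kk j != -1 -> mm j != (kk j + 1) * mm i ->
  free [:: x1; x2; x3; x4; x5; x14; x25; x114].
Proof.
move=> i1 j1 ki nj kj D.
apply: (free_T (p := fun c i => c 0%N + c 4%N * mm i)
  (q := fun c i => c 1%N + c 3%N * kk i + c 7%N * kk i ^+ 2)
  (r := fun c i => c 2%N + c 5%N * kk i - c 6%N * mm i)); first expand_T.
move=> c []; rewrite kk1 mm1 => p1 q1 r1 H.
have [qj _ /(_ nj)[pj rj]] := H j j1; have [qi pi _] := H i i1.
have mj := mm_neq0 j1; have mi := mm_neq0 i1; rewrite ki in qi pi.
have kj' : kk j + 1 != 0 by rewrite addr_eq0.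
have c0 : c 0%N = 0 by lra.
have c4 : c 4%N = 0 by apply: (cancel0 mj); lra.
have c1 : c 1%N = 0 by lra.
have c37 : c 3%N = c 7%N by lra.
have c7 : c 7%N = 0.
  by apply: (cancel0 kj'); apply: (cancel0 nj); rewrite c1 c37 in qj; lra.
have c3 : c 3%N = 0 by rewrite c37.
have bi : be i != 0.
  apply: contra_eq_neq ki => /= bi.
  by rewrite /kk bi expr0n mulr0 add0r oppr_eq0 oner_eq0.
have c26 : c 2%N = c 6%N * mm i.
  apply/eqP; rewrite -subr_eq0; apply/eqP/(cancel0 (e0 i))/(cancel0 bi).
  by rewrite -pi c0 c4; ring.
have c6 : c 6%N = 0.
  apply: (@cancel0 _ ((kk j + 1) * mm i - mm j)).
    by rewrite subr_eq0 eq_sym.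
  have c25 : c 5%N = c 6%N * mm i by lra.
  by rewrite c26 c25 in rj; lra.
have c2 : c 2%N = 0 by rewrite c26 c6 mul0r.
have c5 : c 5%N = 0 by lra.
by do 8?[case=> //].
Qed.

(** The [r] part is affine in [(k, m)] and vanishes at three points, which the last hypothesis makes
    non-collinear. *)
Lemma free_branch8 : kk 0 != 0 -> kk 2 != 0 -> kk 0 != -1 -> kk 2 != -1 ->
  kk 0 != kk 2 -> (kk 0 + 1) * mm 2 != (kk 2 + 1) * mm 0 ->
  free [:: x1; x2; x3; x4; x5; x14; x25; x114; x214].
Proof.
move=> n0 n2 k0 k2 k02 D.
apply: (free_T (p := fun c i => c 0%N + c 4%N * mm i + c 8%N * (mm i * kk i))
  (q := fun c i => c 1%N + c 3%N * kk i + c 7%N * kk i ^+ 2)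
  (r := fun c i => c 2%N + c 5%N * kk i - c 6%N * mm i)); first expand_T.
move=> c []; rewrite kk1 mm1 => p1 q1 r1 H.
have [q0 _ /(_ n0)[p0 r0]] := H 0 isT; have [q2 _ /(_ n2)[p2 r2]] := H 2 isT.
have k2' : -1 != kk 2 by rewrite eq_sym.
have [c1 c3 c7] := quadratic_eq0 k0 k02 k2' q0 q1 q2.
have c0 : c 0%N = 0 by lra.
have [||c4 c8] := @det_mk (c 4%N) (c 8%N) k02; [lra|lra|].
have D' : (kk 0 + 1) * - mm 2 - - mm 0 * (kk 2 + 1) != 0.
  by apply: contra_neq D => D; lra.
have [||c5 c6] := @det2_eq0 _ _ _ _ (c 5%N) (c 6%N) D'; [lra|lra|].
have c2 : c 2%N = 0 by rewrite c5 c6 in r0; lra.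
by do 9?[case=> //].
Qed.

End Branches.

(** * Growth vectors in the model *)

Section Growth.
Variable R : realType.
Variables (be e : 'I_3 -> R).
Hypothesis be1 : be 1 = 0.
Hypothesis e0 : forall i, e i != 0.

Local Notation x1 := (x1 be).
Local Notation x2 := (x2 e).
Local Notation x3 := (x3 be e).
Local Notation x4 := (x4 be e).
Local Notation x5 := (x5 be e).
Local Notation x14 := (x14 be e).
Local Notation x25 := (x25 be e).
Local Notation x114 := (x114 be e).
Local Notation x214 := (x214 be e).
Local Notation x125 := (x125 be e).
Local Notation x225 := (x225 be e).
Local Notation x1114 := (x1114 be e).
Local Notation kk := (kk be).
Local Notation mm := (mm e).
Local Notation flag := (flag (@sl2e2 R) x1 x2).
Let brE := sl2e2_brE be e.

Definition growth_concl (s : seq 'M[R]_3) (gv : seq nat) :=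
  let d := [set field_of x1; field_of x2] in
  let L := lie_generated (@lie_bracket R) (@vector_fields R) d in
  [/\ lie_subalgebra (@lie_bracket R) (@vector_fields R) L,
      is_basis L (map (@field_of R) s)
    & growth_vector (@lie_bracket R) d gv].

Lemma kk_be1 i : i != 1 -> be i = 1 -> kk i = 0.
Proof. by move=> i1 bi; rewrite /kk /tau i1 bi expr1n mulr1 subrr. Qed.

(** The hypothesis, valid for [b = 1 / 2], is the collinear case: [m] is affine in [k]. *)
Lemma x25_half : (forall i, mm i = - 4 * (kk i + 1)) ->
  x25 = 4 *: x3 + 4 *: x14.
Proof.
by move=> mm_half; apply: matrix3P => i; rewrite !mxE /= mm_half; split; ring.
Qed.

(** [k] takes only the values [-1] and [kk 0], so its square reduces by the quadratic with these
    roots. *)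
Lemma x114_1a : kk 0 = kk 2 -> x114 = (kk 0 - 1) *: x4 + kk 0 *: x2.
Proof.
move=> k02; have quad i : (kk i + 1) * (kk i - kk 0) = 0.
  move: i; apply: ord3_ind; rewrite ?kk1 // -?k02 ?subrr ?mulr0 //.
  by rewrite addNr mul0r.
apply: matrix3P => i; rewrite !mxE /=; split; try ring.
apply/eqP; rewrite -subr_eq0 -[X in _ == X](mulr0 (e i)) -(quad i).
by apply/eqP; ring.
Qed.

Lemma x214_1a : (forall i, mm i = - 4 * (kk i + 1)) -> kk 0 = kk 2 ->
  x214 = kk 0 *: x5.
Proof.
move=> mk k02; have quad i : (kk i + 1) * (kk i - kk 0) = 0.
  move: i; apply: ord3_ind; rewrite ?kk1 // -?k02 ?subrr ?mulr0 //.
  by rewrite addNr mul0r.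
apply: matrix3P => i; rewrite !mxE /= mk; split; try ring;
  apply/eqP; rewrite -subr_eq0.
  by rewrite -[X in _ == X](mulr0 (- 4)) -(quad i); apply/eqP; ring.
by rewrite -[X in _ == X](mulr0 (- 4 * be i)) -(quad i); apply/eqP; ring.
Qed.

Section OneB.
Hypotheses (b0 : be 0 = 1) (b2 : be 2 = 1).
Let k0 := kk_be1 (i := 0) isT b0.
Let k2 := kk_be1 (i := 2) isT b2.

Lemma x114_1b : x114 = - x4.
Proof.
apply: matrix3P => i; rewrite !mxE /=; split; try ring.
by move: i; apply: ord3_ind; rewrite ?k0 ?kk1 ?k2; ring.
Qed.

Lemma x214_1b : x214 = 0.
Proof.
apply: matrix3P => i; rewrite !mxE /=; split=> //;
by move: i; apply: ord3_ind; rewrite ?k0 ?k2 ?mm1; ring.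
Qed.

(** On the outer summands [x25], [x3 + x14] and [x5] are E + C times [e i ^+ 3], [e i] and
    [- e i ^+ 2]; the coefficients come from the quadratic with roots [e 0] and [e 2]. All three
    vanish on the middle summand. *)
Lemma x25_1b : x25 = - (e 0 * e 2) *: (x3 + x14) - (e 0 + e 2) *: x5.
Proof.
apply: matrix3P => i; rewrite !mxE /=; split;
by move: i; apply: ord3_ind;
  rewrite ?b0 ?be1 ?b2 ?k0 ?k2 ?kk1 ?mm1 /mm /tau /=; ring.
Qed.

End OneB.

Lemma growth_full s gv : free s -> size s = 9%N -> (0 < size gv)%N ->
  [&& sorted ltn gv, all (fun n => n <= 9)%N gv & last 0%N gv == 9%N] ->
  (forall i, (i < (size gv).-1)%N -> flag i = <<take (nth 0%N gv i) s>>%VS) ->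
  all [in flag (size gv).-1] s -> growth_concl s gv.
Proof.
move=> fs s9 gv0 gvs flagE sflag; rewrite -s9 in gvs.
apply: (growth_of_flag_in (@sl2e2N R) (@sl2e2J R) (@field_of_inj R)
  (@field_of_br R) (@field_of_vector_fields R) (W := fullv)) => // *;
  by rewrite ?memvf // s9 dimvf.
Qed.

(** Its kernel is the hyperplane E = C that contains the whole algebra when [be i = 1]. *)
Definition E_sub_C (i : 'I_3) (u : 'M[R]_3) : R^o := u i 0 - u i 1.

Lemma E_sub_C_is_linear i : linear (E_sub_C i).
Proof. by move=> a u v; rewrite /E_sub_C !mxE /GRing.scale /=; ring. Qed.

HB.instance Definition _ i := GRing.isLinear.Build R 'M[R]_3 R^o _
  (E_sub_C i) (E_sub_C_is_linear i).

Lemma mem_hyper i u : (u \in lker (linfun (E_sub_C i))) = (u i 0 == u i 1).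
Proof. by rewrite memv_ker lfunE /= subr_eq0. Qed.

Lemma growth_hyper i s gv : i != 1 -> be i = 1 ->
  free s -> size s = 8%N -> (0 < size gv)%N ->
  [&& sorted ltn gv, all (fun n => n <= 8)%N gv & last 0%N gv == 8%N] ->
  (forall i, (i < (size gv).-1)%N -> flag i = <<take (nth 0%N gv i) s>>%VS) ->
  all [in flag (size gv).-1] s -> growth_concl s gv.
Proof.
move=> i1 bi fs s8 gv0 gvs flagE sflag; rewrite -s8 in gvs.
have H1 : x1 i 0 = x1 i 1 by rewrite !mxE /= bi mulr1.
have H2 : x2 i 0 = x2 i 1 by rewrite !mxE.
have H (u v : 'M[R]_3) : u i 0 = u i 1 -> v i 0 = v i 1 ->
    sl2e2 u v i 0 = sl2e2 u v i 1.
  by rewrite !mxE /= /tau i1 => -> ->; rewrite mul1r; ring.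
apply: (growth_of_flag_in (@sl2e2N R) (@sl2e2J R) (@field_of_inj R)
  (@field_of_br R) (@field_of_vector_fields R)
  (W := lker (linfun (E_sub_C i)))) => //; rewrite ?mem_hyper ?H1 ?H2 ?eqxx //.
(* The kernel is proper, since the matrix unit for E on summand [i] lies outside it. *)
- rewrite s8 leqNgt; apply/negP => W9.
  have : (lker (linfun (E_sub_C i)) == fullv)%VS by rewrite eqEdim subvf dimvf.
  move/eqP/vspaceP/(_ (delta_mx i 0)); rewrite mem_hyper memvf !mxE !eqxx /=.
  by rewrite mulr1n mulr0n oner_eq0.
- by move=> u; rewrite !mem_hyper => /eqP ?; apply/eqP; exact: H.
- by move=> u; rewrite !mem_hyper => /eqP ?; apply/eqP; exact: H.
Qed.

Lemma growth_branch4 i j : i != 1 -> j != 1 -> be i = 1 -> be j = 0 ->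
  growth_concl [:: x1; x2; x3; x4; x5; x14; x25; x125] [:: 2; 3; 5; 7; 8]%N.
Proof.
move=> i1 j1 bi bj; apply: (growth_hyper i1 bi) => //.
- apply: (free_branch4 be1 e0 i1 j1); rewrite ?bi ?oner_eq0 //.
    by rewrite /kk /tau i1 bi expr1n mulr1 subrr.
  by rewrite /kk bj expr0n mulr0 add0r.
- by case=> [|[|[|[|//]]]] _; rewrite ?(flag1 brE) ?(flag2 brE) ?(flag3 brE).
- by rewrite (flag4 brE) /= !memv_span // !inE eqxx ?orbT.
Qed.

Lemma growth_branch5 : kk 0 = kk 2 -> kk 0 != 0 -> kk 0 != -1 -> mm 0 != mm 2 ->
  growth_concl [:: x1; x2; x3; x4; x5; x14; x25; x125; x225]
               [:: 2; 3; 5; 7; 9]%N.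
Proof.
move=> k02 n0 k0 m02; apply: growth_full => //; first exact: free_branch5.
- by case=> [|[|[|[|//]]]] _; rewrite ?(flag1 brE) ?(flag2 brE) ?(flag3 brE).
- by rewrite (flag4 brE) /= !memv_span // !inE eqxx ?orbT.
Qed.

Lemma growth_branch6 i j : i != 1 -> j != 1 ->
  kk i != 0 -> kk i != -1 -> kk j = -1 ->
  growth_concl [:: x1; x2; x3; x4; x5; x14; x25; x214; x125]
               [:: 2; 3; 5; 7; 9]%N.
Proof.
move=> i1 j1 ni ki kj; apply: growth_full => //.
- exact: free_branch6 i1 j1 ni ki kj.
- by case=> [|[|[|[|//]]]] _; rewrite ?(flag1 brE) ?(flag2 brE) ?(flag3 brE).
- by rewrite (flag4 brE) /= !memv_span // !inE eqxx ?orbT.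
Qed.

Lemma growth_branch7 i j : i != 1 -> j != 1 -> be i = 1 ->
  kk j != 0 -> kk j != -1 -> mm j != (kk j + 1) * mm i ->
  growth_concl [:: x1; x2; x3; x4; x5; x14; x25; x114] [:: 2; 3; 5; 7; 8]%N.
Proof.
move=> i1 j1 bi nj kj D; apply: (growth_hyper i1 bi) => //.
- exact: free_branch7 i1 j1 (kk_be1 i1 bi) nj kj D.
- by case=> [|[|[|[|//]]]] _; rewrite ?(flag1 brE) ?(flag2 brE) ?(flag3 brE).
- by rewrite (flag4 brE) /= !memv_span // !inE eqxx ?orbT.
Qed.

Lemma growth_branch8 : kk 0 != 0 -> kk 2 != 0 -> kk 0 != -1 -> kk 2 != -1 ->
  kk 0 != kk 2 -> (kk 0 + 1) * mm 2 != (kk 2 + 1) * mm 0 ->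
  growth_concl [:: x1; x2; x3; x4; x5; x14; x25; x114; x214]
               [:: 2; 3; 5; 7; 9]%N.
Proof.
move=> *; apply: growth_full => //; first exact: free_branch8.
- by case=> [|[|[|[|//]]]] _; rewrite ?(flag1 brE) ?(flag2 brE) ?(flag3 brE).
- by rewrite (flag4 brE) /= !memv_span // !inE eqxx ?orbT.
Qed.

Section Half.
Hypothesis mm_half : forall i, mm i = - 4 * (kk i + 1).

Lemma x25_dep : x25 \in <<[:: x1; x2; x3; x4; x5; x14]>>%VS.
Proof.
by rewrite (x25_half mm_half) memvD ?memvZ ?memv_span ?inE ?eqxx ?orbT.
Qed.

Lemma growth_branch2 i j : i != 1 -> j != 1 ->
  be i = 1 -> kk j != 0 -> kk j != -1 ->
  growth_concl [:: x1; x2; x3; x4; x5; x14; x114; x214] [:: 2; 3; 5; 6; 8]%N.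
Proof.
move=> i1 j1 bi nj kj; apply: (growth_hyper i1 bi) => //.
- exact: free_branch2 i1 j1 (kk_be1 i1 bi) nj kj.
- by case=> [|[|[|[|//]]]] _; rewrite ?(flag1 brE) ?(flag2 brE)
    ?(flag3_dep brE x25_dep).
- by rewrite (flag4_dep brE x25_dep) /= !memv_span // !inE eqxx ?orbT.
Qed.

Lemma growth_branch3 : kk 0 != 0 -> kk 2 != 0 -> kk 0 != -1 -> kk 2 != -1 ->
  kk 0 != kk 2 ->
  growth_concl [:: x1; x2; x3; x4; x5; x14; x114; x214; x1114]
               [:: 2; 3; 5; 6; 8; 9]%N.
Proof.
move=> *; apply: growth_full => //; first exact: free_branch3.
- by case=> [|[|[|[|[|//]]]]] _; rewrite ?(flag1 brE) ?(flag2 brE)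
    ?(flag3_dep brE x25_dep) ?(flag4_dep brE x25_dep).
(* Only the last element [x1114] is new in [flag 5]; the first eight span [flag 4]. *)
- apply/allP => x; rewrite (mem_rcons [:: _; _; _; _; _; _; _; _] _ _) inE.
  case/orP => [/eqP ->|xs]; first exact: flag5_dep brE x25_dep.
  apply: (subvP (bracket_stepS _ _ _ (flag 4))).
  by rewrite (flag4_dep brE x25_dep) memv_span.
Qed.

End Half.

Lemma growth_span6 : let s := [:: x1; x2; x3; x4; x5; x14] in
  free s -> all [in << s >>%VS] [:: x25; x114; x214] ->
  growth_concl s [:: 2; 3; 5; 6]%N.
Proof.
move=> s fs dep; have dep25 : x25 \in << s >>%VS by case/and4P: dep.
apply: (growth_of_flag_in (@sl2e2N R) (@sl2e2J R) (@field_of_inj R)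
  (@field_of_br R) (@field_of_vector_fields R) (W := << s >>%VS)) => //.
- by case=> [|[|[|//]]] _; rewrite ?(flag1 brE) ?(flag2 brE).
- by rewrite (flag3_dep brE dep25); apply/allP => x; exact: memv_span.
- exact: dim_span.
- by rewrite memv_span ?inE ?eqxx.
- by rewrite memv_span ?inE ?eqxx ?orbT.
- by move=> u us; apply: (span6_closed brE dep _ us); rewrite inE eqxx.
- by move=> u us; apply: (span6_closed brE dep _ us); rewrite !inE eqxx orbT.
Qed.

Lemma growth_branch1a : (forall i, mm i = - 4 * (kk i + 1)) -> kk 0 = kk 2 ->
  kk 0 != 0 -> kk 0 != -1 ->
  growth_concl [:: x1; x2; x3; x4; x5; x14] [:: 2; 3; 5; 6]%N.
Proof.
move=> mk k02 n0 k0; apply: growth_span6; first exact: free_branch1a.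
rewrite /= (x25_half mk) (x114_1a k02) (x214_1a mk k02).
by rewrite ?memvD ?memvZ ?memv_span ?inE ?eqxx ?orbT.
Qed.

Lemma growth_branch1b : be 0 = 1 -> be 2 = 1 -> e 0 != e 2 ->
  growth_concl [:: x1; x2; x3; x4; x5; x14] [:: 2; 3; 5; 6]%N.
Proof.
move=> b0 b2 e02; have k0 := kk_be1 (i := 0) isT b0.
have k2 := kk_be1 (i := 2) isT b2.
apply: growth_span6; first exact: free_branch1b.
rewrite /= (x25_1b b0 b2) (x114_1b b0 b2) (x214_1b b0 b2).
by rewrite ?mem0v ?memvB ?memvN ?memvZ ?memvD ?memv_span ?inE ?eqxx ?orbT.
Qed.

End Growth.

(** * The parameters *)

Section Linkage.
Variables (R : realType) (l1 l3 b : R).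
Hypotheses (hl1 : 0 < l1) (hl3 : 0 < l3) (hb0 : 0 <= b) (hb1 : b <= 1).

Definition par_be (i : 'I_3) : R := [:: b / l1; 0; (1 - b) / l3]`_i.
(** The minus sign is that of the [v1] component of [X2]; it keeps [e 0] and [e 2] distinct even
    when [l1 = l3]. *)
Definition par_e (i : 'I_3) : R := [:: - l1^-1; 1; l3^-1]`_i.
Local Notation be := par_be.
Local Notation e := par_e.
Local Notation kk := (kk be).
Local Notation mm := (mm e).

Let l1n : l1 != 0. Proof. by rewrite gt_eqF. Qed.
Let l3n : l3 != 0. Proof. by rewrite gt_eqF. Qed.

Lemma par_be1 : be 1 = 0. Proof. by []. Qed.

Lemma par_e_neq0 i : e i != 0.
Proof.
by move: i; apply: ord3_ind; rewrite /e /= ?oppr_eq0 ?invr_eq0 ?oner_eq0.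
Qed.

Lemma field1E : field1 l1 l3 b = field_of (x1 be).
Proof.
apply/funext => p; apply/rowP => i; rewrite !mxE.
by case: i => -[|[|[|[|[|//]]]]] Hi; rewrite /= /trig ?mxE /be /=; ring.
Qed.

Lemma field2E : field2 l1 l3 b = field_of (x2 e).
Proof.
apply/funext => p; apply/rowP => i; rewrite !mxE.
by case: i => -[|[|[|[|[|//]]]]] Hi; rewrite /= /trig ?mxE /e /=; ring.
Qed.

Let kk0E : kk 0 = (b / l1) ^+ 2 - 1. Proof. by rewrite /kk /tau /= mul1r. Qed.
Let kk2E : kk 2 = ((1 - b) / l3) ^+ 2 - 1.
Proof. by rewrite /kk /tau /= mul1r. Qed.
Let mm0E : mm 0 = - l1^-1 ^+ 2. Proof. by rewrite /mm /tau /= mul1r sqrrN. Qed.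
Let mm2E : mm 2 = - l3^-1 ^+ 2. Proof. by rewrite /mm /tau /= mul1r. Qed.

Let bl0 : 0 <= b / l1. Proof. by rewrite divr_ge0 // ltW. Qed.
Let bl2 : 0 <= (1 - b) / l3. Proof. by rewrite divr_ge0 ?subr_ge0 // ltW. Qed.

(** Since [b / l1] is nonnegative, its square is [1] only if it is [1]. *)
Lemma kk0_neq0 : b != l1 -> kk 0 != 0.
Proof.
apply: contra_neq => /eqP; rewrite kk0E subr_eq0 sqrp_eq1 // => /eqP.
by move/(canRL (mulfVK l1n)); rewrite mul1r.
Qed.

Lemma kk2_neq0 : b != 1 - l3 -> kk 2 != 0.
Proof.
apply: contra_neq => /eqP; rewrite kk2E subr_eq0 sqrp_eq1 // => /eqP.
move/(canRL (mulfVK l3n)); rewrite mul1r; lra.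
Qed.

Lemma kk0_neqN1 : b != 0 -> kk 0 != -1.
Proof.
move=> b0; rewrite kk0E -subr_eq0 opprK subrK expf_eq0 /= mulf_eq0 invr_eq0.
by rewrite (negbTE b0) (negbTE l1n).
Qed.

Lemma kk2_neqN1 : b != 1 -> kk 2 != -1.
Proof.
move=> b0; rewrite kk2E -subr_eq0 opprK subrK expf_eq0 /= mulf_eq0 invr_eq0.
by rewrite subr_eq0 eq_sym (negbTE b0) (negbTE l3n).
Qed.

Lemma kk02_neq : b != l1 / (l1 + l3) -> kk 0 != kk 2.
Proof.
apply: contra_neq; rewrite kk0E kk2E => /addIr /eqP.
rewrite eqrXn2 // => /eqP H.
have n : l1 + l3 != 0 by rewrite gt_eqF // addr_gt0.
have {}H : b * l3 = (1 - b) * l1.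
  transitivity (b / l1 * (l1 * l3)); first by field.
  by rewrite H; field.
apply: (mulIf n); rewrite divfK //; lra.
Qed.

Lemma kk02_eq : b = l1 / (l1 + l3) -> kk 0 = kk 2.
Proof.
move=> bE; rewrite kk0E kk2E bE; congr (_ ^+ 2 - 1).
have n : l1 + l3 != 0 by rewrite gt_eqF // addr_gt0.
by field; rewrite l1n l3n n.
Qed.

(** Clearing denominators turns equality into [b ^+ 2 = (1 - b) ^+ 2], that is [b = 1 / 2] for [b]
    in the unit interval. *)
Lemma det_neq : b != 1 / 2 -> (kk 0 + 1) * mm 2 != (kk 2 + 1) * mm 0.
Proof.
apply: contra_neq; rewrite kk0E kk2E mm0E mm2E !subrK !mulrN => /oppr_inj H.
have {}H : b ^+ 2 = (1 - b) ^+ 2.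
  transitivity ((b / l1) ^+ 2 * l3^-1 ^+ 2 * (l1 * l3) ^+ 2).
    by field; rewrite l1n l3n.
  by rewrite H; field; rewrite l1n l3n.
have /eqP := H; rewrite eqrXn2 ?subr_ge0 // => /eqP; lra.
Qed.

Lemma mm_half : b = 1 / 2 -> forall i, mm i = - 4 * (kk i + 1).
Proof.
move=> bE; apply: ord3_ind.
- by rewrite mm0E kk0E bE; field.
- by rewrite mm1 kk1 addNr mulr0.
- by rewrite mm2E kk2E bE; field.
Qed.

Lemma mm02_neq : l1 != l3 -> mm 0 != mm 2.
Proof.
apply: contra_neq; rewrite mm0E mm2E => /oppr_inj /eqP.
by rewrite eqrXn2 ?invr_ge0 ?ltW // => /eqP /invr_inj.
Qed.

Lemma be0_eq1 : b = l1 -> be 0 = 1.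
Proof. by move=> bE; rewrite /be /= bE divff. Qed.

Lemma be2_eq1 : b = 1 - l3 -> be 2 = 1.
Proof. by move=> bE; rewrite /be /= bE opprB addrC subrK divff. Qed.

Lemma be0_eq0 : b = 0 -> be 0 = 0.
Proof. by move=> bE; rewrite /be /= bE mul0r. Qed.

Lemma be2_eq0 : b = 1 -> be 2 = 0.
Proof. by move=> bE; rewrite /be /= bE subrr mul0r. Qed.

Lemma e02_neq : e 0 != e 2.
Proof.
by rewrite lt_eqF // /e /=; apply: (@lt_trans _ _ 0);
  rewrite ?oppr_lt0 invr_gt0.
Qed.

Lemma branch_cover :
  [\/ branch1 l1 l3 b, branch2 l1 l3 b, branch3 l1 l3 b | branch4 l1 l3 b] \/
  [\/ branch5 l1 l3 b, branch6 l1 l3 b, branch7 l1 l3 b | branch8 l1 l3 b].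
Proof.
have n : l1 + l3 != 0 by rewrite gt_eqF // addr_gt0.
have [bh|bh] := eqVneq b (1 / 2).
  left; have [e13|n13] := eqVneq l1 l3; first by apply: Or41; left.
  have [e1|n1] := eqVneq l1 b.
    by apply: Or42; left; split; rewrite -?bh // -e1.
  have [e3|n3] := eqVneq l3 b.
    by apply: Or42; right; split; rewrite -?bh // eq_sym.
  by apply: Or43.
have [b0|b0] := eqVneq b 0.
  have [e3|n3] := eqVneq l3 1; first by left; apply: Or44; right.
  by right; apply: Or42; right.
have [bb1|bb1] := eqVneq b 1.
  have [e1|n1] := eqVneq l1 1.
    by left; apply: Or44; left; split; rewrite // bb1.
  by right; apply: Or42; left.
have [b1|b1] := eqVneq b l1.
  have [s|s] := eqVneq (l1 + l3) 1.
    by left; apply: Or41; right; split=> //; rewrite -s b1 addrK.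
  by right; apply: Or43; left.
have [b3|b3] := eqVneq b (1 - l3).
  have [s|s] := eqVneq (l1 + l3) 1.
    by left; apply: Or41; right; split=> //; rewrite b3 -s addrK.
  by right; apply: Or43; right.
(* The side conditions of branch 5 follow from the excluded values: [l1 = l3] would give
   [b = 1 / 2], and [l1 + l3 = 1] would give [b = l1]. *)
have [b5|b5] := eqVneq b (l1 / (l1 + l3)).
  right; apply: Or41; split=> //.
    apply: contra_neq bh => e13; rewrite b5 e13; field.
    by rewrite -mulr2n mulrn_eq0.
  by apply: contra_neq b1 => s; rewrite b5 s divr1.
by right; apply: Or44; rewrite /branch8 !inE !negb_or b0 bh bb1 b1 b3 b5.
Qed.

Local Notation x3 := (x3 be e).
Local Notation x4 := (x4 be e).
Local Notation x5 := (x5 be e).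
Local Notation x14 := (x14 be e).
Local Notation x25 := (x25 be e).
Local Notation x114 := (x114 be e).
Local Notation x214 := (x214 be e).
Local Notation x125 := (x125 be e).
Local Notation x225 := (x225 be e).
Local Notation x1114 := (x1114 be e).
Local Notation x1 := (x1 be).
Local Notation x2 := (x2 e).
Local Notation growth_concl := (growth_concl be e).

Lemma model_branch1 : branch1 l1 l3 b ->
  growth_concl [:: x1; x2; x3; x4; x5; x14] [:: 2; 3; 5; 6]%N.
Proof.
(* The split is by degeneracy of the outer summands, because [b = l1 = l3 = 1 / 2] satisfies case a)
   yet needs the degenerate argument of case b). *)
have [b1|b1] := eqVneq b l1; have [b3|b3] := eqVneq b (1 - l3).
- move=> _; apply: (growth_branch1b par_be1 par_e_neq0);
    [exact: be0_eq1 | exact: be2_eq1 | exact: e02_neq].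
- move=> [[bh e13]|[e1 e3]]; last by rewrite e3 eqxx in b3.
  by case/eqP: b3; lra.
- move=> [[bh e13]|[e1 e3]]; last by rewrite e1 eqxx in b1.
  by case/eqP: b1; lra.
move=> [[bh e13]|[e1 e3]]; last by rewrite e1 eqxx in b1.
apply: growth_branch1a par_be1 par_e_neq0 _ _ _ _;
  rewrite ?kk0_neq0 ?kk0_neqN1 //.
- exact: mm_half.
- by rewrite kk0E kk2E e13 bh; congr (_ ^+ 2 - 1); field.
- by rewrite bh; apply/eqP; lra.
Qed.

Lemma model_branch2 : branch2 l1 l3 b ->
  growth_concl [:: x1; x2; x3; x4; x5; x14; x114; x214] [:: 2; 3; 5; 6; 8]%N.
Proof.
move=> [[b1 h n3]|[b3 h n1]].
- have bh : b = 1 / 2 by rewrite b1.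
  apply: (growth_branch2 par_be1 par_e_neq0 (mm_half bh)
    (i := 0) (j := 2)) => //.
  + exact: be0_eq1.
  + by apply: kk2_neq0; apply: contra_neq n3 => n3; lra.
  + by apply: kk2_neqN1; rewrite bh; apply/eqP; lra.
- have bh : b = 1 / 2 by rewrite b3.
  apply: (growth_branch2 par_be1 par_e_neq0 (mm_half bh)
    (i := 2) (j := 0)) => //.
  + by apply: be2_eq1; lra.
  + by apply: kk0_neq0; rewrite bh.
  + by apply: kk0_neqN1; rewrite bh; apply/eqP; lra.
Qed.

Lemma model_branch3 : branch3 l1 l3 b ->
  growth_concl [:: x1; x2; x3; x4; x5; x14; x114; x214; x1114]
               [:: 2; 3; 5; 6; 8; 9]%N.
Proof.
move=> [bh n13 n1 n3]; apply: (growth_branch3 par_be1 par_e_neq0 (mm_half bh)).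
- by apply: kk0_neq0; rewrite eq_sym.
- by apply: kk2_neq0; apply: contra_neq n3 => n3; lra.
- by apply: kk0_neqN1; rewrite bh; apply/eqP; lra.
- by apply: kk2_neqN1; rewrite bh; apply/eqP; lra.
- apply: kk02_neq; apply: contra_neq n13; rewrite bh => H.
  have n : l1 + l3 != 0 by rewrite gt_eqF // addr_gt0.
  by move/(canRL (divfK n)): (esym H) => {}H; lra.
Qed.

Lemma model_branch4 : branch4 l1 l3 b ->
  growth_concl [:: x1; x2; x3; x4; x5; x14; x25; x125] [:: 2; 3; 5; 7; 8]%N.
Proof.
move=> [[b1 h]|[b0 h]].
- apply: (growth_branch4 par_be1 par_e_neq0 (i := 0) (j := 2)) => //.
    exact: be0_eq1.
  by apply: be2_eq0; rewrite b1.
- apply: (growth_branch4 par_be1 par_e_neq0 (i := 2) (j := 0)) => //.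
    by apply: be2_eq1; rewrite b0 h subrr.
  exact: be0_eq0.
Qed.

Lemma model_branch5 : branch5 l1 l3 b ->
  growth_concl [:: x1; x2; x3; x4; x5; x14; x25; x125; x225]
               [:: 2; 3; 5; 7; 9]%N.
Proof.
move=> [bE n13 s]; have n : l1 + l3 != 0 by rewrite gt_eqF // addr_gt0.
apply: (growth_branch5 par_be1 par_e_neq0).
- exact: kk02_eq.
- apply: kk0_neq0; apply: contra_neq s => b1; apply: (mulfI l1n).
  by rewrite mulr1 -{1}b1 bE divfK.
- by apply: kk0_neqN1; rewrite bE mulf_neq0 ?invr_eq0.
- exact: mm02_neq.
Qed.

Lemma model_branch6 : branch6 l1 l3 b ->
  growth_concl [:: x1; x2; x3; x4; x5; x14; x25; x214; x125]
               [:: 2; 3; 5; 7; 9]%N.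
Proof.
move=> [[b1 h]|[b0 h]].
- apply: (growth_branch6 par_be1 par_e_neq0 (i := 0) (j := 2)) => //.
  + by apply: kk0_neq0; rewrite b1 eq_sym.
  + by apply: kk0_neqN1; rewrite b1 oner_eq0.
  + by rewrite kk2E b1 subrr mul0r expr0n add0r.
- apply: (growth_branch6 par_be1 par_e_neq0 (i := 2) (j := 0)) => //.
  + by apply: kk2_neq0; rewrite b0; apply: contra_neq h => h; lra.
  + by apply: kk2_neqN1; rewrite b0 eq_sym oner_eq0.
  + by rewrite kk0E b0 mul0r expr0n add0r.
Qed.

Lemma model_branch7 : branch7 l1 l3 b ->
  growth_concl [:: x1; x2; x3; x4; x5; x14; x25; x114] [:: 2; 3; 5; 7; 8]%N.
Proof.
move=> [[b1 s bh bb1]|[b3 s b0 bh]].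
- have k0 : kk 0 = 0 by apply: kk_be1 => //; exact: be0_eq1.
  apply: (growth_branch7 par_be1 par_e_neq0 (i := 0) (j := 2)) => //.
  + exact: be0_eq1.
  + by apply: kk2_neq0; apply: contra_neq s => s; lra.
  + exact: kk2_neqN1.
  + by have := det_neq bh; rewrite k0 add0r mul1r.
- have k2 : kk 2 = 0 by apply: kk_be1 => //; exact: be2_eq1.
  apply: (growth_branch7 par_be1 par_e_neq0 (i := 2) (j := 0)) => //.
  + exact: be2_eq1.
  + by apply: kk0_neq0; apply: contra_neq s => s; lra.
  + exact: kk0_neqN1.
  + by have := det_neq bh; rewrite k2 add0r mul1r eq_sym.
Qed.

Lemma model_branch8 : branch8 l1 l3 b ->
  growth_concl [:: x1; x2; x3; x4; x5; x14; x25; x114; x214]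
               [:: 2; 3; 5; 7; 9]%N.
Proof.
rewrite /branch8 !inE !negb_or => /and5P[b0 bh bb1 b1 /andP[b3 b5]].
by apply: (growth_branch8 par_be1 par_e_neq0);
  [exact: kk0_neq0|exact: kk2_neq0|exact: kk0_neqN1|exact: kk2_neqN1|
   exact: kk02_neq|exact: det_neq].
Qed.

End Linkage.

(** * From the matrix model back to the vector fields *)

Theorem proposition6 (R : realType) (l1 l3 b : R)
    (hl1 : 0 < l1) (hl3 : 0 < l3) (hb0 : 0 <= b) (hb1 : b <= 1) :
  let br := @lie_bracket R in
  let X1 := field1 l1 l3 b in
  let X2 := field2 l1 l3 b in
  let X3 := br X1 X2 in
  let X4 := br X1 X3 in
  let X5 := br X2 X3 in
  let X14 := br X1 X4 in
  let X25 := br X2 X5 in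
  let X114 := br X1 X14 in
  let X214 := br X2 X14 in
  let X125 := br X1 X25 in
  let X225 := br X2 X25 in
  let X1114 := br X1 X114 in
  let d := [set X1; X2] in
  let s := lie_generated br (@vector_fields R) d in
  let basis_growth B g := is_basis s B /\ growth_vector br d g in
  [/\ lie_subalgebra br (@vector_fields R) s,
      exists2 n, has_dim s n & n \in [:: 6; 8; 9]%N,
      [\/ branch1 l1 l3 b, branch2 l1 l3 b, branch3 l1 l3 b | branch4 l1 l3 b] \/
      [\/ branch5 l1 l3 b, branch6 l1 l3 b, branch7 l1 l3 b | branch8 l1 l3 b]
    & [/\ branch1 l1 l3 b ->
            basis_growth [:: X1; X2; X3; X4; X5; X14] [:: 2; 3; 5; 6]%N,
          branch2 l1 l3 b ->
            basis_growth [:: X1; X2; X3; X4; X5; X14; X114; X214]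
                         [:: 2; 3; 5; 6; 8]%N,
          branch3 l1 l3 b ->
            basis_growth [:: X1; X2; X3; X4; X5; X14; X114; X214; X1114]
                         [:: 2; 3; 5; 6; 8; 9]%N,
          branch4 l1 l3 b ->
            basis_growth [:: X1; X2; X3; X4; X5; X14; X25; X125]
                         [:: 2; 3; 5; 7; 8]%N
        & [/\ branch5 l1 l3 b ->
                basis_growth [:: X1; X2; X3; X4; X5; X14; X25; X125; X225]
                             [:: 2; 3; 5; 7; 9]%N,
              branch6 l1 l3 b ->
                basis_growth [:: X1; X2; X3; X4; X5; X14; X25; X214; X125]
                             [:: 2; 3; 5; 7; 9]%N,
              branch7 l1 l3 b ->
                basis_growth [:: X1; X2; X3; X4; X5; X14; X25; X114]
                             [:: 2; 3; 5; 7; 8]%N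
            & branch8 l1 l3 b ->
                basis_growth [:: X1; X2; X3; X4; X5; X14; X25; X114; X214]
                             [:: 2; 3; 5; 7; 9]%N]]].
Proof.
move=> br X1 X2 X3 X4 X5 X14 X25 X114 X214 X125 X225 X1114 d s basis_growth.
pose be := par_be l1 l3 b; pose e := par_e l1 l3.
have brE u v : br (field_of u) (field_of v) = field_of (sl2e2 u v).
  exact: esym (field_of_br u v).
have E1 : X1 = field_of (x1 be) by exact: field1E.
have E2 : X2 = field_of (x2 e) by exact: field2E.
have E3 : X3 = field_of (x3 be e) by rewrite /X3 E1 E2 brE br12.
have E4 : X4 = field_of (x4 be e) by rewrite /X4 E1 E3 brE br13.
have E5 : X5 = field_of (x5 be e) by rewrite /X5 E2 E3 brE br23.
have E14 : X14 = field_of (x14 be e) by rewrite /X14 E1 E4 brE br14.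
have E25 : X25 = field_of (x25 be e) by rewrite /X25 E2 E5 brE br25.
have E114 : X114 = field_of (x114 be e) by rewrite /X114 E1 E14 brE br114.
have E214 : X214 = field_of (x214 be e) by rewrite /X214 E2 E14 brE br214.
have E125 : X125 = field_of (x125 be e) by rewrite /X125 E1 E25 brE br125.
have E225 : X225 = field_of (x225 be e) by rewrite /X225 E2 E25 brE br225.
have E1114 : X1114 = field_of (x1114 be e) by rewrite /X1114 E1 E114 brE br1114.
pose G B gv := [/\ lie_subalgebra br (@vector_fields R) s, is_basis s B
  & growth_vector br d gv].
have GE l gv : growth_concl be e l gv -> G (map (@field_of R) l) gv.
  by rewrite /growth_concl /G /s /d -E1 -E2.
have G1 (h : branch1 l1 l3 b) :
    G [:: X1; X2; X3; X4; X5; X14] [:: 2; 3; 5; 6]%N.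
  have := GE _ _ (model_branch1 hl1 hl3 hb0 h).
  by rewrite /= -E1 -E2 -E3 -E4 -E5 -E14.
have G2 (h : branch2 l1 l3 b) :
    G [:: X1; X2; X3; X4; X5; X14; X114; X214]
    [:: 2; 3; 5; 6; 8]%N.
  have := GE _ _ (model_branch2 hl1 hl3 hb0 hb1 h).
  by rewrite /= -E1 -E2 -E3 -E4 -E5 -E14 -E114 -E214.
have G3 (h : branch3 l1 l3 b) :
    G [:: X1; X2; X3; X4; X5; X14; X114; X214; X1114]
    [:: 2; 3; 5; 6; 8; 9]%N.
  have := GE _ _ (model_branch3 hl1 hl3 hb0 hb1 h).
  by rewrite /= -E1 -E2 -E3 -E4 -E5 -E14 -E114 -E214 -E1114.
have G4 (h : branch4 l1 l3 b) :
    G [:: X1; X2; X3; X4; X5; X14; X25; X125]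
    [:: 2; 3; 5; 7; 8]%N.
  have := GE _ _ (model_branch4 hl1 hl3 h).
  by rewrite /= -E1 -E2 -E3 -E4 -E5 -E14 -E25 -E125.
have G5 (h : branch5 l1 l3 b) :
    G [:: X1; X2; X3; X4; X5; X14; X25; X125; X225]
    [:: 2; 3; 5; 7; 9]%N.
  have := GE _ _ (model_branch5 hl1 hl3 hb0 h).
  by rewrite /= -E1 -E2 -E3 -E4 -E5 -E14 -E25 -E125 -E225.
have G6 (h : branch6 l1 l3 b) :
    G [:: X1; X2; X3; X4; X5; X14; X25; X214; X125]
    [:: 2; 3; 5; 7; 9]%N.
  have := GE _ _ (model_branch6 hl1 hl3 hb0 hb1 h).
  by rewrite /= -E1 -E2 -E3 -E4 -E5 -E14 -E25 -E214 -E125.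
have G7 (h : branch7 l1 l3 b) :
    G [:: X1; X2; X3; X4; X5; X14; X25; X114]
    [:: 2; 3; 5; 7; 8]%N.
  have := GE _ _ (model_branch7 hl1 hl3 hb0 hb1 h).
  by rewrite /= -E1 -E2 -E3 -E4 -E5 -E14 -E25 -E114.
have G8 (h : branch8 l1 l3 b) :
    G [:: X1; X2; X3; X4; X5; X14; X25; X114; X214]
    [:: 2; 3; 5; 7; 9]%N.
  have := GE _ _ (model_branch8 hl1 hl3 hb0 hb1 h).
  by rewrite /= -E1 -E2 -E3 -E4 -E5 -E14 -E25 -E114 -E214.
have cover := branch_cover b hl1 hl3.
(* Since the branches cover all parameters, some branch supplies the subalgebra property and a basis
   whose length is the dimension. *)
have [B [gv [[Lie basis _] sizeB]]] :
    exists B gv, G B gv /\ size B \in [:: 6; 8; 9]%N.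
  by case: cover => [[/G1|/G2|/G3|/G4]|[/G5|/G6|/G7|/G8]] GB; do 2 eexists;
    (split; first exact: GB).
split=> //; first by exists (size B) => //; exists B.
by split; [move=> /G1[]|move=> /G2[]|move=> /G3[]|move=> /G4[]|
  split; [move=> /G5[]|move=> /G6[]|move=> /G7[]|move=> /G8[]]].
Qed.
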